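(* Suppose $\nabla\widehat f$ is approximated from samples of $f$, with $\widetilde{\operatorname{grad}}f(r):=\mathrm Dg^\star(0\,|\,r)\,G_r^{-1}\,\nabla p^f_r(0)$, $G_r:=\mathrm Dg^\star(0\,|\,r)^T\mathrm Dg^\star(0\,|\,r)$. Suppose $f$ is gradient $L$-Lipschitz on $\operatorname{Conv}(\widetilde{\mathcal M}\cup\mathcal M)$, $f\ge f^\star>-\infty$ on $\mathcal M\cup\widetilde{\mathcal M}$, and the approximate-retraction domain assumption (see context) holds with radius $Q$. For $p\in\mathcal M$ write $$E(p):=\big(2c_{\mathcal M}\|\nabla f(p)\|+c_{\widetilde{\mathcal M}}\|\nabla f(p)\|+c_f+c_{\mathrm{MMLS}}\big)\sqrt D\,h^m .$$ Let $\bar\alpha>0$, $\gamma\in(0,1)$, $\delta\in(0,0.25)$. Consider the algorithm $x_{i+1}:=\widetilde R_{x_i}(-\alpha_i\widetilde{\operatorname{grad}}f(x_i))$ started at $x_0\in\widetilde{\mathcal M}$, with $p_i\in\mathcal M$ such that $\mathcal P_m^h(p_i)=x_i$, where $\alpha_i$ is determined by the backtracking procedure (see context) at $x_i$ with parameters $\gamma,\delta$ and initial step-size $$\widehat\alpha_i:=\min\left\{\bar\alpha,\ \frac{Q}{\|\widetilde{\operatorname{grad}}f(x_i)\|}\right\}>0 .$$ Suppose all iterations are performed at points of $\widetilde{\mathcal M}$ where $\widetilde{\mathcal M}$ is a manifold, $h$ is small enough such that $6L_v\le Q$, and $\max\{6L_v/\bar\alpha,\ 2E(p_i)\}\le\|\widetilde{\operatorname{grad}}f(x_i)\|$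 holds for all the iterations. Then for any $\varepsilon>0$, provided enough iterations are performed, the algorithm returns a point $x\in\widetilde{\mathcal M}$ such that, with $p\in\mathcal M$ satisfying $\mathcal P_m^h(p)=x$, $f(x)\le f(x_0)$ and $$\|\widetilde{\operatorname{grad}}f(x)\|\le\max\left\{\frac{6L_v}{\bar\alpha},\ 2E(p)\right\}+\varepsilon=:\varepsilon_6(\widetilde{\mathcal M}).\tag{a}$$ In addition, $$\|\operatorname{grad}_{\mathcal M}f(p)\|\le(c_f+2c_{\mathcal M}G)\sqrt D\,h^m+\varepsilon_6(\widetilde{\mathcal M}),\tag{b}$$ where $\|\nabla f(p)\|\le G$, and $\|p-x\|\le c_{\mathrm{MMLS}}\sqrt D\,h^{m+1}$. Moreover, when $h\to0$ the bound in (b) goes to $\varepsilon$, and the quantities $6L_v$ and $\max\{6L_v/\bar\alpha,\ 2E(p_i)\}$ go to $0$. Finally, if $\varepsilon_6(\widetilde{\mathcal M})>Q\big/\min\{\bar\alpha,\ 2\gamma(0.25-\delta)/\widetilde L\}$, the bounds (a) and (b) are achieved in at most $$\left\lceil\frac{f(x_0)-f^\star}{Q\,\delta}\cdot\frac1{\varepsilon_6(\widetilde{\mathcal M})}\right\rceil$$ iterations, and if $\varepsilon_6(\widetilde{\mathcal M})\le Q\big/\min\{\bar\alpha,\ 2\gamma(0.25-\delta)/\widetilde L\}$, they are achieved in at most $$\left\lceil\frac{f(x_0)-f^\star}{\delta\min\left\{\bar\alpha,\ \frac{2\gamma(0.25-\delta)}{\widetilde L}\right\}}\cdot\frac1{\varepsilon_6(\widetilde{\mathcal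 M})^2}\right\rceil$$ iterations. Each iteration $i$ requires at most $$\max\left\{1,\ 2+\log_{\gamma^{-1}}\left(\frac{\widehat\alpha_i\,\widetilde L}{2\gamma\left(\frac{\beta_i}2-\delta\right)}\right)\right\}$$ retractions and cost function evaluations (assuming $f(x_0)$ and $\widetilde{\operatorname{grad}}f(x_0)$ were already computed), where $\beta_i:=1-\dfrac{E(p_i)}{\|\widetilde{\operatorname{grad}}f(x_i)\|}>0$.
   Context: Norms: $\|\cdot\|$ is the Euclidean norm on vectors and the spectral norm on matrices; $B_\delta(x)$ is the open ball; $\Pi_V$ is orthogonal projection onto $V$. ''Gradient $L$-Lipschitz on $\operatorname{Conv}(\widetilde{\mathcal M}\cup\mathcal M)$'' means $\|\nabla f(y)-\nabla f(x)\|\le L\|y-x\|$ for all $x,y$ in the convex hull of $\widetilde{\mathcal M}\cup\mathcal M$. $f:\mathbb R^D\to\mathbb R$ is sufficiently smooth. Setting. $\mathcal M$ ($\in C^2$) is a closed (compact, boundaryless) smooth $d$-dimensional submanifold of $\mathbb R^D$ with positive reach $\mathrm{rch}(\mathcal M)$ (the largest $\tau$ such that every point at distance $<\tau$ from $\mathcal M$ has a unique nearest point in $\mathcal M$). $S=\{r_i\}_{i=1}^n\subset\mathcal M$ is a quasi-uniform sample set with respect to $\mathcal M$: with fill distance $h=\sup_{x\in\mathcal M}\min_i\|x-r_i\|$ and separation radius $\delta_S=\tfrac12\min_{i\ne j}\|r_i-r_j\|$, one has $\delta_S\le h\le c_{qu}\delta_S$ for a constant $c_{qu}>0$. The samples $f(r_i)$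 are given. The metric is the standard inner product of $\mathbb R^D$; $\operatorname{grad}_{\mathcal M}f(p)=\Pi_{T_p\mathcal M}(\nabla f(p))$, $\operatorname{grad}_{\widetilde{\mathcal M}}f(r)=\Pi_{T_r\widetilde{\mathcal M}}(\nabla f(r))$. MMLS projection of degree $m\ge1$. For $r\in\mathbb R^D$ close to $\mathcal M$: Step 1: $(q(r),H(r))$ minimizes $\sum_i d(r_i-q,H)^2\theta_1(\|r_i-q\|)$ over $q\in\mathbb R^D$ and $d$-dimensional linear subspaces $H\subset\mathbb R^D$, subject to $r-q\perp H$, $q\in B_\mu(r)$, $S\cap B_h(q)\ne\emptyset$. Step 2: let $q_i$ be the orthogonal projection of $r_i-q(r)$ onto $H(r)\simeq\mathbb R^d$; $g^\star(\cdot\,|\,r):H(r)\to\mathbb R^D$ minimizes $\sum_i\|g(q_i)-r_i\|^2\theta_h(\|r_i-q(r)\|)$ over $\mathbb R^D$-valued polynomials of total degree at most $m$. Then $\mathcal P_m^h(r):=g^\star(0\,|\,r)$ and $\widetilde{\mathcal M}:=\{\mathcal P_m^h(p):p\in\mathcal M\}$. Weights: $\theta_1,\theta_h\ge0$, $\theta_h(th)=\Phi(t)$ for a fixed $\Phi$; they are smooth (away from singularities at $0$), monotonically decaying, supported on $[0,c_1h]$ with $c_1>3$, $\theta_1(c_2h)>c_3>0$ and $\theta_h(c_2h)>c_3>0$ for some constants $c_2<c_1$, $\lim_{t\to0}\theta_h(t)=\infty$, and $\mu=\mathrm{rch}(\mathcal M)/2$. It is assumed that there is an $\epsilon$-neighborhood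 of $\mathcal M$ on which the Step 1 problem has a unique local minimum $q(x)\in B_\mu(x)$; $U_{\mathrm{unique}}$ is the largest such neighborhood. $h$ is assumed small enough (including $hL\le1$) for the known facts: $\mathcal P_m^h:\mathcal M\to\widetilde{\mathcal M}$ is a bijection; $\widetilde{\mathcal M}$ is compact and almost everywhere a smooth $d$-dimensional manifold; $\mathcal P_m^h(U_{\mathrm{unique}})\subset\widetilde{\mathcal M}$; if $p\in\mathcal M$, $\mathcal P_m^h(p)=r$, then $q(r)=q(p)$, $H(r)=H(p)$, $g^\star(\cdot|r)=g^\star(\cdot|p)$, $\mathcal P_m^h(r)=r$. Local parametrizations: near $0\in H(p)$, $\varphi$ and $\widetilde\varphi$ are the local parametrizations of $\mathcal M$ and $\widetilde{\mathcal M}$ sending $x$ to the nearby point $y$ of the set for which $y-q(p)$ projects orthogonally onto $x$ in $H(p)$; $\varphi(0)=p$, $\widetilde\varphi(0)=\mathcal P_m^h(p)$. Function approximation: $\widehat f:=f\circ\varphi$ on $H(r)$; $p^f_r$ minimizes $\sum_i|p(q_i)-f(r_i)|^2\theta_3(\|r_i-q(r)\|)$ over real polynomials $p$ on $H(r)\simeq\mathbb R^d$ of total degree at most $m$, where $\theta_3\ge0$ is a $C^\infty$ weight (away from $0$), locally supported or rapidly decreasing, $\theta_3(th)=\Psi(t)$, $\lim_{t\to0}\theta_3(t)=\infty$. Constants (independent of $p$, $v$): $c_{\mathrm{MMLS}}$ satisfies $\|\mathcal P_m^h(p)-p\|\le c_{\mathrm{MMLS}}\sqrt D\,h^{m+1}$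 for all $p\in\mathcal M$; $c_{\mathcal M},c_{\widetilde{\mathcal M}}$ satisfy, for all $p\in\mathcal M$, $x\in B_{c_1h}(0)\subset H(p)$, unit $v\in\mathbb R^d$: $\|\mathrm Dg^\star(x|p)[v]-\mathrm D\varphi(x)[v]\|_\infty\le c_{\mathcal M}h^m$ and $\|\mathrm Dg^\star(x|p)[v]-\mathrm D\widetilde\varphi(x)[v]\|_\infty\le c_{\widetilde{\mathcal M}}h^m$; $c_f$ satisfies $\|\nabla p^f_r(x)-\nabla\widehat f(x)\|_\infty\le c_fh^m$ for $x\in B_{c_1h}(0)\subset H(r)$. Approximate components: $\widetilde T_r\widetilde{\mathcal M}:=\operatorname{Range}(\mathrm Dg^\star(0\,|\,r))$ for $r\in\widetilde{\mathcal M}$; $\widetilde R_r(\xi):=\mathcal P_m^h(r+\xi)$ for $\xi\in\widetilde T_r\widetilde{\mathcal M}$. Approximate-retraction domain assumption: for each $r\in\widetilde{\mathcal M}$ there is $Q_r>0$ with $r+\xi\in U_{\mathrm{unique}}$ for all $\xi\in\widetilde T_r\widetilde{\mathcal M}$, $\|\xi\|\le Q_r$, and $Q:=\inf_rQ_r>0$; $K:=\{(r,\xi):r\in\widetilde{\mathcal M},\xi\in\widetilde T_r\widetilde{\mathcal M},\|\xi\|\le Q\}$ (compact). For $(r,\xi)\in K$, $\mathrm D\widetilde R_r(0_r)[\xi]=\xi+v'_{r,\xi}(0)\in T_r\widetilde{\mathcal M}$, where $v_{r,\xi}(t)\in H(r+t\xi)^\perp$ is smooth in $t$ near $0$ with $t\xi+v_{r,\xi}(t)\in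 T_r\widetilde{\mathcal M}$; $L_v>0$ is a constant with $\|v'_{r,\xi}(0)\|\le L_v$ on $K$, and $L_v\to0$ as $h\to0$. $\widetilde L>0$ is a constant with $|f(\widetilde R_r(\xi))-[f(r)+\langle\operatorname{grad}_{\widetilde{\mathcal M}}f(r),\xi+v'_{r,\xi}(0)\rangle]|\le\frac{\widetilde L}2\|\xi\|^2$ for all $(r,\xi)\in K$. $G$ is a finite bound of $\|\nabla f\|$ on $\mathcal M$. Backtracking procedure at $x$ with initial step-size $\widehat\alpha$ and parameters $\gamma,\delta$: set $\alpha\leftarrow\widehat\alpha$; while $f(x)-f(\widetilde R_x(-\alpha\,\widetilde{\operatorname{grad}}f(x)))<\delta\alpha\|\widetilde{\operatorname{grad}}f(x)\|^2$, replace $\alpha\leftarrow\gamma\alpha$; return $\alpha$. *)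

(* Defs.v *)
From HB Require Import structures.
From mathcomp Require Import all_boot all_order all_algebra.
From mathcomp Require Import all_classical all_reals all_analysis.
Set Implicit Arguments.
Unset Strict Implicit.
Unset Printing Implicit Defensive.
Import Order.TTheory GRing.Theory Num.Theory.
Import numFieldNormedType.Exports.
Local Open Scope classical_set_scope.
Local Open Scope ring_scope.

(* Vectors are rows, so a linear map R^d -> R^D is a 'M_(d, D) acting on the
   right, and every matrix below is the transpose of the textbook one.
   The library norm `|x| on 'rV[R]_n is the sup norm; enorm is the Euclidean
   norm.  Both induce the same topology and the same derivatives. *)
Definition dot (R : realType) n (x y : 'rV[R]_n) : R :=
  \sum_(i < n) x 0 i * y 0 i.

Definition enorm (R : realType) n (x : 'rV[R]_n) : R := Num.sqrt (dot x x).

Definition eball (R : realType) n (x : 'rV[R]_n) (rho : R) : set 'rV[R]_n :=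
  [set y | enorm (y - x) < rho].

(* The vector 0 is a junk value, taken only if no projection exists; the
   projection exists and is unique when V is a linear subspace. *)
Definition oproj (R : realType) n (V : set 'rV[R]_n) (x : 'rV[R]_n) :
    'rV[R]_n :=
  xget 0 [set w | V w /\ forall u, V u -> dot (x - w) u = 0].

Definition dist_to (R : realType) n (V : set 'rV[R]_n) (x : 'rV[R]_n) : R :=
  inf [set enorm (x - u) | u in V].

Definition gradient (R : realType) n (f : 'rV[R]_n -> R) (x : 'rV[R]_n) :
    'rV[R]_n :=
  \row_j 'D_(delta_mx 0 j) f x.

Definition convex_hull (R : realType) n (A : set 'rV[R]_n) : set 'rV[R]_n :=
  [set x | forall C : set 'rV[R]_n, @convex_set R 'rV[R]_n C ->
     A `<=` C -> C x].

(* [:: v1; ...; vk] |-> D_v1 (... (D_vk f)) *)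
Fixpoint iter_derive (R : realType) n (W : normedModType R)
    (vs : seq 'rV[R]_n) (f : 'rV[R]_n -> W) : 'rV[R]_n -> W :=
  if vs is v :: vs' then fun x => 'D_v (iter_derive vs' f) x else f.

Definition Ck_on (k : nat) (R : realType) n (W : normedModType R)
    (f : 'rV[R]_n -> W) (U : set 'rV[R]_n) : Prop :=
  forall (vs : seq 'rV[R]_n) (x : 'rV[R]_n), U x ->
    ((size vs < k)%N -> differentiable (iter_derive vs f) x) /\
    ((size vs <= k)%N -> {for x, continuous (iter_derive vs f)}).

Definition smooth_on (R : realType) n (W : normedModType R)
    (f : 'rV[R]_n -> W) (U : set 'rV[R]_n) : Prop :=
  forall k, Ck_on k f U.

(* A is, near x, an embedded d-dimensional submanifold without boundary:
   psi is an immersion of an open U and a homeomorphism of U onto an open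
   part of A. *)
Definition manifold_at (R : realType) (D d : nat)
    (reg : ('rV[R]_d -> 'rV[R]_D) -> set 'rV[R]_d -> Prop)
    (A : set 'rV[R]_D) (x : 'rV[R]_D) : Prop :=
  exists (psi : 'rV[R]_d -> 'rV[R]_D) (chi : 'rV[R]_D -> 'rV[R]_d)
         (U : set 'rV[R]_d) (W : set 'rV[R]_D),
    [/\ open U, U 0, psi 0 = x & open W] /\
    [/\ psi @` U = A `&` W, {in U, cancel psi chi},
        {within A `&` W, continuous chi}, reg psi U
      & forall u, U u -> row_free ('J psi u)].

Definition C2_manifold_at (R : realType) (D d : nat) (A : set 'rV[R]_D) :=
  @manifold_at R D d (fun psi U => Ck_on 2 psi U) A.

Definition smooth_manifold_at (R : realType) (D d : nat) (A : set 'rV[R]_D) :=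
  @manifold_at R D d (fun psi U => smooth_on psi U) A.

Definition tangent (R : realType) D (A : set 'rV[R]_D) (x : 'rV[R]_D) :
    set 'rV[R]_D :=
  [set w | exists c : R -> 'rV[R]_D,
     [/\ c 0 = x, \forall t \near (0 : R), A (c t)
       & is_derive (0 : R) 1 c w]].

Definition Rgrad (R : realType) D (A : set 'rV[R]_D) (f : 'rV[R]_D -> R)
    (x : 'rV[R]_D) : 'rV[R]_D :=
  oproj (tangent A x) (gradient f x).

(* Vanishing d-dimensional Hausdorff measure (0 < d): covers by balls whose
   radii have arbitrarily small sum of d-th powers. *)
Definition hausdorff_null (R : realType) D (d : nat) (A : set 'rV[R]_D) :
    Prop :=
  forall e : R, 0 < e -> exists (c : nat -> 'rV[R]_D) (rho : nat -> R),
    [/\ forall i, 0 <= rho i, A `<=` \bigcup_i eball (c i) (rho i)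
      & forall n, \sum_(i < n) rho i ^+ d <= e].

Definition tube (R : realType) D (A : set 'rV[R]_D) (tau : R) :
    set 'rV[R]_D :=
  [set x | exists2 a, A a & enorm (x - a) < tau].

Definition unique_nearest (R : realType) D (A : set 'rV[R]_D) (tau : R) :
    Prop :=
  forall x, tube A tau x ->
    exists! a, A a /\ forall b, A b -> enorm (x - a) <= enorm (x - b).

Definition is_reach (R : realType) D (A : set 'rV[R]_D) (tau : R) : Prop :=
  unique_nearest A tau /\ forall tau', unique_nearest A tau' -> tau' <= tau.

Definition fill_distance (R : realType) D n (A : set 'rV[R]_D)
    (r : 'I_n -> 'rV[R]_D) : R :=
  sup [set inf (range (fun i => enorm (x - r i))) | x in A].

Definition separation_radius (R : realType) D n (r : 'I_n -> 'rV[R]_D) : R :=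
  2^-1 * inf [set enorm (r ij.1 - r ij.2) |
                ij in [set ij : 'I_n * 'I_n | ij.1 != ij.2]].

(* Weights are extended-real valued because they may be +oo at 0; since
   0 * +oo = 0, an infinite weight in a weighted sum of squares forces the
   corresponding residual to vanish. *)
Definition weight (R : realType) (theta : R -> \bar R) : Prop :=
  (forall t, (0 <= theta t)%E) /\
  forall t, 0 < t -> theta t \is a fin_num /\
    forall k, derivable (derive1n k (fine \o theta)) t 1.

Definition decaying_on (R : realType) (c : R) (theta : R -> \bar R) : Prop :=
  (forall s t, 0 <= s <= t -> (theta t <= theta s)%E) /\
  forall t, c < t -> theta t = 0%E.

Definition singular_at0 (R : realType) (theta : R -> \bar R) : Prop :=
  theta 0 = +oo%E /\ theta t @[t --> 0^'+] --> +oo%E.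

(* total degree at most m; each exponent is then at most m *)
Definition polyfun (m : nat) (R : realType) d (p : 'rV[R]_d -> R) : Prop :=
  exists c : {ffun 'I_d -> 'I_m.+1} -> R, forall x,
    p x = \sum_(a : {ffun 'I_d -> 'I_m.+1} | (\sum_i a i <= m)%N)
            c a * \prod_i x 0 i ^+ a i.

Definition polymap (m : nat) (R : realType) d D
    (g : 'rV[R]_d -> 'rV[R]_D) : Prop :=
  forall j, polyfun m (fun x => g x 0 j).

Record problem (R : realType) (D d : nat) := Problem {
  manif : set 'rV[R]_D;
  rch : R;
  degree : nat;
  (* an orthonormal basis of each d-dimensional subspace H, i.e. the
     identification of H with R^d *)
  frame : {vspace 'rV[R]_D} -> 'M[R]_(d, D);
  c_qu : R;
  c_1 : R;
  c_2 : R;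
  c_3 : R;
  Phi : R -> \bar R;
  Psi : R -> \bar R;
  cost : 'rV[R]_D -> R;
  fstar : R;
  lip : R;
  Gmax : R;
  c_M : R;
  c_Mt : R;
  c_f : R;
  c_MMLS : R
}.

Record problem_spec (R : realType) (D d : nat) (pb : problem R D d) : Prop := {
  dim_gt0 : (0 < d)%N;
  manif_compact : compact (manif pb);
  manif_C2 : forall x, manif pb x -> C2_manifold_at d (manif pb) x;
  rch_gt0 : 0 < rch pb;
  rchP : is_reach (manif pb) (rch pb);
  degree_gt0 : (0 < degree pb)%N;
  frameP : forall H : {vspace 'rV[R]_D}, \dim H = d ->
    frame pb H *m (frame pb H)^T = 1%:M /\
    forall x, x \in H <-> exists c : 'rV[R]_d, x = c *m frame pb H;
  c_qu_gt0 : 0 < c_qu pb;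
  c_1_gt3 : 3 < c_1 pb;
  c_2P : 0 < c_2 pb < c_1 pb;
  c_3_gt0 : 0 < c_3 pb;
  cost_C1 : Ck_on 1 (cost pb) setT;
  lip_ge0 : 0 <= lip pb;
  GmaxP : forall x, manif pb x -> enorm (gradient (cost pb) x) <= Gmax pb
}.

Section MMLS.
Context (R : realType) (D d : nat) (pb : problem R D d).

Record mmls := Mmls {
  nsamples : nat;
  sample : 'I_nsamples -> 'rV[R]_D;
  hfill : R;
  theta1 : R -> \bar R;
  thetah : R -> \bar R;
  theta3 : R -> \bar R;
  qpt : 'rV[R]_D -> 'rV[R]_D;
  Hsp : 'rV[R]_D -> {vspace 'rV[R]_D};
  gstar : 'rV[R]_D -> 'rV[R]_d -> 'rV[R]_D;
  pf : 'rV[R]_D -> 'rV[R]_d -> R;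
  (* phi p, phit p: local parametrizations of M and of the approximating
     manifold over H(p) *)
  phi : 'rV[R]_D -> 'rV[R]_d -> 'rV[R]_D;
  phit : 'rV[R]_D -> 'rV[R]_d -> 'rV[R]_D;
  Qr : 'rV[R]_D -> R;
  vcurve : 'rV[R]_D -> 'rV[R]_D -> R -> 'rV[R]_D;
  Lv : R;
  Ltil : R
}.

Variable s : mmls.

Let r := @sample s.
Let h := hfill s.

(* coordinates in H ~ R^d of the orthogonal projection of x onto H *)
Definition coord (H : {vspace 'rV[R]_D}) (x : 'rV[R]_D) : 'rV[R]_d :=
  x *m (frame pb H)^T.

Definition step1_feasible (x q : 'rV[R]_D) (H : {vspace 'rV[R]_D}) : Prop :=
  [/\ \dim H = d, forall u, u \in H -> dot (x - q) u = 0,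
      eball x (rch pb / 2) q & exists i, eball q h (r i)].

Definition step1_obj (q : 'rV[R]_D) (H : {vspace 'rV[R]_D}) : \bar R :=
  (\sum_(i < nsamples s)
     (dist_to [set` H] (r i - q) ^+ 2)%:E * theta1 s (enorm (r i - q)))%E.

Definition step1_min (x q : 'rV[R]_D) (H : {vspace 'rV[R]_D}) : Prop :=
  step1_feasible x q H /\ forall q' H', step1_feasible x q' H' ->
    (step1_obj q H <= step1_obj q' H')%E.

(* Subspaces are compared through the gap between orthogonal projectors. *)
Definition step1_locmin (x q : 'rV[R]_D) (H : {vspace 'rV[R]_D}) : Prop :=
  step1_feasible x q H /\ exists2 eta : R, 0 < eta &
    forall q' H', step1_feasible x q' H' -> enorm (q' - q) < eta ->
      (forall u, enorm u <= 1 ->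
         enorm (oproj [set` H'] u - oproj [set` H] u) < eta) ->
      (step1_obj q H <= step1_obj q' H')%E.

Definition unique_at (x : 'rV[R]_D) : Prop :=
  exists! q, exists H, step1_locmin x q H.

(* the union of all eps-neighborhoods of M on which Step 1 has a unique
   local minimum, i.e. the largest one *)
Definition Uunique : set 'rV[R]_D :=
  [set x | exists e : R,
     [/\ 0 < e, tube (manif pb) e `<=` unique_at & tube (manif pb) e x]].

Definition step2_obj (x : 'rV[R]_D) (g : 'rV[R]_d -> 'rV[R]_D) : \bar R :=
  (\sum_(i < nsamples s)
     (enorm (g (coord (Hsp s x) (r i - qpt s x)) - r i) ^+ 2)%:E
       * thetah s (enorm (r i - qpt s x)))%E.

Definition step2_min (x : 'rV[R]_D) (g : 'rV[R]_d -> 'rV[R]_D) : Prop :=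
  polymap (degree pb) g /\ forall g', polymap (degree pb) g' ->
    (step2_obj x g <= step2_obj x g')%E.

Definition fit_obj (x : 'rV[R]_D) (p : 'rV[R]_d -> R) : \bar R :=
  (\sum_(i < nsamples s)
     (`|p (coord (Hsp s x) (r i - qpt s x)) - cost pb (r i)| ^+ 2)%:E
       * theta3 s (enorm (r i - qpt s x)))%E.

Definition fit_min (x : 'rV[R]_D) (p : 'rV[R]_d -> R) : Prop :=
  polyfun (degree pb) p /\ forall p', polyfun (degree pb) p' ->
    (fit_obj x p <= fit_obj x p')%E.

Definition Pm (x : 'rV[R]_D) : 'rV[R]_D := gstar s x 0.

Definition Mt : set 'rV[R]_D := Pm @` manif pb.

(* psi parametrizes A near a over the ball of radius rho of H, by sending u
   to the point y of A near psi u for which y - q projects onto u; it is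
   differentiable wherever A is a manifold. *)
Definition local_param (man : 'rV[R]_D -> Prop) (A : set 'rV[R]_D) (rho : R)
    (q : 'rV[R]_D) (H : {vspace 'rV[R]_D}) (a : 'rV[R]_D)
    (psi : 'rV[R]_d -> 'rV[R]_D) : Prop :=
  psi 0 = a /\ forall u, enorm u < rho ->
    [/\ A (psi u), coord H (psi u - q) = u, {for u, continuous psi},
        man (psi u) -> differentiable psi u
      & \forall y \near psi u, A y -> psi (coord H (y - q)) = y].

(* transpose of Dg*(0 | x) *)
Definition Dg0 (x : 'rV[R]_D) : 'M[R]_(d, D) := 'J (gstar s x) 0.

Definition Tt (x : 'rV[R]_D) : set 'rV[R]_D :=
  range (fun c : 'rV[R]_d => c *m Dg0 x).

Definition gradt (x : 'rV[R]_D) : 'rV[R]_D :=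
  gradient (pf s x) 0 *m invmx (Dg0 x *m (Dg0 x)^T) *m Dg0 x.

Definition Rt (x xi : 'rV[R]_D) : 'rV[R]_D := Pm (x + xi).

Definition Qret : R := inf (Qr s @` Mt).

Definition Kdom : set ('rV[R]_D * 'rV[R]_D) :=
  [set z | [/\ Mt z.1, Tt z.1 z.2 & enorm z.2 <= Qret]].

Definition vprime (x xi : 'rV[R]_D) : 'rV[R]_D := derive1 (vcurve s x xi) 0.

Definition Mt_manifold_at : 'rV[R]_D -> Prop := @smooth_manifold_at R D d Mt.

Record mmls_spec : Prop := {
  samples_ge2 : (1 < nsamples s)%N;
  sample_in : forall i, manif pb (r i);
  hfillP : h = fill_distance (manif pb) r;
  h_gt0 : 0 < h;
  quasi_uniform :
    separation_radius r <= h <= c_qu pb * separation_radius r;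
  theta1P : weight (theta1 s) /\ decaying_on (c_1 pb * h) (theta1 s);
  theta1_pos : ((c_3 pb)%:E < theta1 s (c_2 pb * h))%E;
  thetahP : weight (thetah s) /\ decaying_on (c_1 pb * h) (thetah s);
  thetah_pos : ((c_3 pb)%:E < thetah s (c_2 pb * h))%E;
  thetah_scale : forall t, thetah s (t * h) = Phi pb t;
  thetah_sing : singular_at0 (thetah s);
  theta3P : weight (theta3 s);
  theta3_decay : (exists c, forall t, c < t -> theta3 s t = 0%E) \/
    forall k, t ^+ k * fine (theta3 s t) @[t --> +oo] --> (0 : R);
  theta3_scale : forall t, theta3 s (t * h) = Psi pb t;
  theta3_sing : singular_at0 (theta3 s);
  unique_nbhd : exists2 e : R, 0 < e & tube (manif pb) e `<=` unique_at;
  step1P : forall x, Uunique x -> step1_min x (qpt s x) (Hsp s x);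
  step2P : forall x, Uunique x -> step2_min x (gstar s x) /\
    forall g, step2_min x g -> g = gstar s x;
  fitP : forall x, Mt x -> fit_min x (pf s x);
  (* From here to Pm_fiber: what smallness of h is assumed to provide. *)
  hL_le1 : h * lip pb <= 1;
  Pm_bij : set_bij (manif pb) Mt Pm;
  Mt_compact : compact Mt;
  Mt_smooth_ae : hausdorff_null d (Mt `\` Mt_manifold_at);
  Pm_Uunique : forall x, Uunique x -> Mt (Pm x);
  Pm_fiber : forall p x, manif pb p -> Pm p = x ->
    [/\ qpt s x = qpt s p, Hsp s x = Hsp s p, gstar s x = gstar s p
      & Pm x = x];
  phiP : forall p, manif pb p ->
    local_param (fun=> True) (manif pb) (c_1 pb * h)
      (qpt s p) (Hsp s p) p (phi s p);
  phitP : forall p, manif pb p ->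
    local_param Mt_manifold_at Mt (c_1 pb * h)
      (qpt s p) (Hsp s p) (Pm p) (phit s p);
  c_MMLSP : forall p, manif pb p ->
    enorm (Pm p - p)
      <= c_MMLS pb * Num.sqrt D%:R * h ^+ (degree pb).+1;
  c_MP : forall p x v, manif pb p -> enorm x < c_1 pb * h -> enorm v = 1 ->
    `|'D_v (gstar s p) x - 'D_v (phi s p) x| <= c_M pb * h ^+ degree pb;
  c_MtP : forall p x v, manif pb p -> enorm x < c_1 pb * h -> enorm v = 1 ->
    Mt_manifold_at (phit s p x) ->
    `|'D_v (gstar s p) x - 'D_v (phit s p) x| <= c_Mt pb * h ^+ degree pb;
  c_fP : forall p x, manif pb p -> enorm x < c_1 pb * h ->
    `|gradient (pf s (Pm p)) x - gradient (cost pb \o phi s p) x|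
      <= c_f pb * h ^+ degree pb;
  cost_lip : forall x y,
    convex_hull (Mt `|` manif pb) x -> convex_hull (Mt `|` manif pb) y ->
    enorm (gradient (cost pb) y - gradient (cost pb) x)
      <= lip pb * enorm (y - x);
  cost_ge : forall x, (manif pb `|` Mt) x -> fstar pb <= cost pb x;
  QrP : forall x, Mt x -> 0 < Qr s x /\
    forall xi, Tt x xi -> enorm xi <= Qr s x -> Uunique (x + xi);
  Qret_gt0 : 0 < Qret;
  Kdom_compact : compact Kdom;
  vcurveP : forall x xi, Kdom (x, xi) -> Mt_manifold_at x ->
    (exists2 eta : R, 0 < eta & forall t, `|t| < eta ->
       [/\ forall k, derivable (derive1n k (vcurve s x xi)) t 1,
           forall u, u \in Hsp s (x + t *: xi) -> dot (vcurve s x xi t) u = 0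
         & tangent Mt x (t *: xi + vcurve s x xi t)]) /\
    is_derive (0 : R) 1 (fun t => Rt x (t *: xi)) (xi + vprime x xi) /\
    tangent Mt x (xi + vprime x xi);
  Lv_gt0 : 0 < Lv s;
  LvP : forall x xi, Kdom (x, xi) -> Mt_manifold_at x ->
    enorm (vprime x xi) <= Lv s;
  Ltil_gt0 : 0 < Ltil s;
  LtilP : forall x xi, Kdom (x, xi) -> Mt_manifold_at x ->
    `|cost pb (Rt x xi)
        - (cost pb x + dot (Rgrad Mt (cost pb) x) (xi + vprime x xi))|
      <= Ltil s / 2 * enorm xi ^+ 2
}.

Definition Ebound (p : 'rV[R]_D) : R :=
  (2 * c_M pb * enorm (gradient (cost pb) p)
   + c_Mt pb * enorm (gradient (cost pb) p) + c_f pb + c_MMLS pb)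
  * Num.sqrt D%:R * h ^+ degree pb.

Definition threshold (abar : R) (p : 'rV[R]_D) : R :=
  Num.max (6 * Lv s / abar) (2 * Ebound p).

Definition eps6 (abar eps : R) (p : 'rV[R]_D) : R := threshold abar p + eps.

Definition bound_M (e : R) : R :=
  (c_f pb + 2 * c_M pb * Gmax pb) * Num.sqrt D%:R * h ^+ degree pb + e.

Definition alpha0 (abar : R) (x : 'rV[R]_D) : R :=
  Num.min abar (Qret / enorm (gradt x)).

Definition insufficient (delta alpha : R) (x : 'rV[R]_D) : Prop :=
  cost pb x - cost pb (Rt x (- (alpha *: gradt x)))
    < delta * alpha * enorm (gradt x) ^+ 2.

(* The procedure exits after exactly k reductions, i.e. after k.+1
   retractions and evaluations of the cost, returning gamma ^+ k * alpha. *)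
Definition backtracks (gamma delta alpha : R) (x : 'rV[R]_D) (k : nat) :
    Prop :=
  (forall j, (j < k)%N -> insufficient delta (gamma ^+ j * alpha) x) /\
  ~ insufficient delta (gamma ^+ k * alpha) x.

(* The first N iterations of the algorithm, all of them satisfying the
   standing hypotheses.  Nothing is said on x i.+1 if backtracking does not
   terminate at x i, so its termination is not presupposed. *)
Record run (abar gamma delta : R) (x0 : 'rV[R]_D) (N : nat)
    (x p : nat -> 'rV[R]_D) : Prop := {
  run_start : x 0%N = x0;
  run_base : forall i, (i <= N)%N -> manif pb (p i) /\ Pm (p i) = x i;
  run_manifold : forall i, (i < N)%N -> Mt_manifold_at (x i);
  run_threshold : forall i, (i < N)%N ->
    threshold abar (p i) <= enorm (gradt (x i));
  run_step : forall i k, (i < N)%N ->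
    backtracks gamma delta (alpha0 abar (x i)) (x i) k ->
    x i.+1 = Rt (x i) (- ((gamma ^+ k * alpha0 abar (x i)) *: gradt (x i)))
}.

Definition achieves (x0 x p : 'rV[R]_D) (e : R) : Prop :=
  [/\ Mt x, cost pb x <= cost pb x0, enorm (gradt x) <= e,
      enorm (Rgrad (manif pb) (cost pb) p) <= bound_M e
    & enorm (p - x) <= c_MMLS pb * Num.sqrt D%:R * h ^+ (degree pb).+1].

Definition step_floor (abar gamma delta : R) : R :=
  Num.min abar (2 * gamma * (4^-1 - delta) / Ltil s).

Definition iter_bound (abar gamma delta : R) (x0 : 'rV[R]_D) (e : R) : int :=
  let a := step_floor abar gamma delta in
  if Qret / a < e
  then Num.ceil ((cost pb x0 - fstar pb) / (Qret * delta) * e^-1)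
  else Num.ceil ((cost pb x0 - fstar pb) / (delta * a) * (e ^+ 2)^-1).

Definition beta (x p : 'rV[R]_D) : R := 1 - Ebound p / enorm (gradt x).

Definition eval_bound (abar gamma delta : R) (x p : 'rV[R]_D) : R :=
  Num.max 1
    (2 + ln (alpha0 abar x * Ltil s / (2 * gamma * (beta x p / 2 - delta)))
         / ln gamma^-1).

End MMLS.

(* Main.v *)
Require Import Defs.
From mathcomp Require Import all_boot all_order all_algebra.
From mathcomp Require Import all_classical all_reals all_analysis.
From mathcomp Require Import ring lra.
Set Implicit Arguments.
Unset Strict Implicit.
Unset Printing Implicit Defensive.
Import Order.TTheory GRing.Theory Num.Theory.
Import numFieldNormedType.Exports.
Local Open Scope classical_set_scope.
Local Open Scope ring_scope.

(** The algorithm is an inexact gradient descent; the proof shows that its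
    errors are small relative to the approximate gradient as long as the latter
    exceeds the threshold, and then runs the classical Armijo argument.

    Fix [p] in the manifold and [x = Pm s p].  Let [A], [B], [C] be the
    differentials at 0 of the polynomial fit and of the parametrizations of the
    manifold and of its approximation over [H(p)].  All three are graphs over
    [H(p)]: followed by the orthogonal projection onto [H(p)] they are the
    identity.  For [B] and [C] this is the meaning of a parametrization over
    [H(p)], and for [A] it follows from the uniqueness of the least-squares fit
    ([gstar_coord]).  Hence none of them shortens a vector
    ([graph_expanding]), pseudo-inverses are contractions, and the hypotheses
    that [A] is [h^m]-close to [B] and [C] turn into estimates without any
    conditioning constant.  Comparing ranges only through inner products with
    tangent vectors ([rowproj_gap]), one finds that along the tangent space of
    the approximating manifold the approximate gradient differs from the exact
    one by at most [E(p)] ([gradt_tangent_error]), and that the gradient on the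
    manifold itself is controlled by the approximate one ([Rgrad_manif_le]).

    The derivative of the approximate retraction in the direction [xi] is
    [xi + v'], where [v'] is homogeneous in [xi] ([vprime_scale]); so
    [6 * Lv <= Q] gives [|v'| <= |xi| / 6] for every admissible [xi].  Together
    with [2 * E <= |gradt|] this leaves a first-order decrease of at least
    [beta / 2 * alpha * |gradt|^2] ([descent]).  As [beta / 2 >= 1/4 > delta],
    every step up to [2 * (beta / 2 - delta) / Ltil] passes the test, so the
    backtracking terminates, with the stated number of evaluations
    ([backtracks_count]), and each iteration lowers the cost by at least
    [delta * min (a * |gradt|^2) (Q * |gradt|)], where [a] is [step_floor]
    ([iteration_decrease]).  Since the cost is bounded below, the approximate
    gradient cannot stay above [e] for longer than the iteration bound
    ([run_reaches]).  The limits for [h] tending to 0 are read off the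
    formulas. *)

(** * Euclidean norms and projections onto row spaces *)

Section Euclid.
Context {R : realType}.
Implicit Types (n D d : nat).

Lemma dotE n (x y : 'rV[R]_n) : dot x y = (x *m y^T) 0 0.
Proof. by rewrite mxE; apply: eq_bigr => i _; rewrite mxE. Qed.

Lemma dotC n (x y : 'rV[R]_n) : dot x y = dot y x.
Proof. by apply: eq_bigr => i _; rewrite mulrC. Qed.

Lemma dotDl n (x y z : 'rV[R]_n) : dot (x + y) z = dot x z + dot y z.
Proof. by rewrite !dotE mulmxDl mxE. Qed.

Lemma dotZl n a (x z : 'rV[R]_n) : dot (a *: x) z = a * dot x z.
Proof. by rewrite !dotE -scalemxAl mxE. Qed.

Lemma dotNl n (x z : 'rV[R]_n) : dot (- x) z = - dot x z.
Proof. by rewrite -scaleN1r dotZl mulN1r. Qed.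

Lemma dotBl n (x y z : 'rV[R]_n) : dot (x - y) z = dot x z - dot y z.
Proof. by rewrite dotDl dotNl. Qed.

Lemma dotDr n (x y z : 'rV[R]_n) : dot x (y + z) = dot x y + dot x z.
Proof. by rewrite !(dotC x) dotDl. Qed.

Lemma dotBr n (x y z : 'rV[R]_n) : dot x (y - z) = dot x y - dot x z.
Proof. by rewrite !(dotC x) dotBl. Qed.

Lemma dotZr n a (x y : 'rV[R]_n) : dot x (a *: y) = a * dot x y.
Proof. by rewrite !(dotC x) dotZl. Qed.

Lemma dot_mulmx n k (c : 'rV[R]_k) (A : 'M[R]_(k, n)) (x : 'rV[R]_n) :
  dot (c *m A) x = dot c (x *m A^T).
Proof. by rewrite !dotE trmx_mul trmxK mulmxA. Qed.

Lemma dot_ge0 n (x : 'rV[R]_n) : 0 <= dot x x.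
Proof. by apply: sumr_ge0 => i _; rewrite -expr2 sqr_ge0. Qed.

Lemma enorm_ge0 n (x : 'rV[R]_n) : 0 <= enorm x.
Proof. exact: sqrtr_ge0. Qed.

Lemma enorm_sq n (x : 'rV[R]_n) : enorm x ^+ 2 = dot x x.
Proof. by rewrite sqr_sqrtr// dot_ge0. Qed.

Lemma enormZ n a (x : 'rV[R]_n) : enorm (a *: x) = `|a| * enorm x.
Proof.
by rewrite /enorm dotZl dotZr mulrA -expr2 sqrtrM ?sqr_ge0// sqrtr_sqr.
Qed.

Lemma enormN n (x : 'rV[R]_n) : enorm (- x) = enorm x.
Proof. by rewrite -scaleN1r enormZ normrN1 mul1r. Qed.

Lemma enorm0 n : enorm (0 : 'rV[R]_n) = 0.
Proof. by rewrite -(scale0r (0 : 'rV[R]_n)) enormZ normr0 mul0r. Qed.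

Lemma enormC n (x y : 'rV[R]_n) : enorm (x - y) = enorm (y - x).
Proof. by rewrite -enormN opprB. Qed.

Lemma enorm_eq0 n (x : 'rV[R]_n) : enorm x = 0 -> x = 0.
Proof.
move=> x0; have /eqP : dot x x = 0 by rewrite -enorm_sq x0 expr0n.
rewrite psumr_eq0 => [/allP x0i|i _]; last by rewrite -expr2 sqr_ge0.
apply/rowP => i; rewrite mxE.
by have := x0i i (mem_index_enum i); rewrite mulf_eq0 orbb => /eqP.
Qed.

Lemma CauchySchwarz_dot n (x y : 'rV[R]_n) : dot x y <= enorm x * enorm y.
Proof.
have [x0|x0] := eqVneq (enorm x) 0.
  rewrite (enorm_eq0 x0) -(scale0r (0 : 'rV[R]_n)) dotZl mul0r.
  by rewrite mulr_ge0 ?enorm_ge0.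
have [y0|y0] := eqVneq (enorm y) 0.
  rewrite (enorm_eq0 y0) -(scale0r (0 : 'rV[R]_n)) dotZr mul0r.
  by rewrite mulr_ge0 ?enorm_ge0.
have xy_gt0 : 0 < enorm x * enorm y.
  by rewrite lt_def mulf_neq0//= mulr_ge0 ?enorm_ge0.
(* This vector vanishes exactly in the case of equality. *)
have := dot_ge0 (enorm y *: x - enorm x *: y).
rewrite dotBl !dotBr !dotZl !dotZr -!enorm_sq (dotC y x).
set u := enorm x in xy_gt0 *; set v := enorm y in xy_gt0 *.
set t := dot x y => ge0.
rewrite -(ler_pM2l xy_gt0); nra.
Qed.

Lemma ler_norm_dot n (x y : 'rV[R]_n) : `|dot x y| <= enorm x * enorm y.
Proof.
rewrite ler_norml CauchySchwarz_dot andbT lerNl -dotNl.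
by rewrite -(enormN x) CauchySchwarz_dot.
Qed.

Lemma ler_enormD n (x y : 'rV[R]_n) : enorm (x + y) <= enorm x + enorm y.
Proof.
rewrite -(@ler_pXn2r _ 2) ?nnegrE ?addr_ge0 ?enorm_ge0//.
rewrite enorm_sq dotDl !dotDr (dotC y x) sqrrD !enorm_sq.
have := CauchySchwarz_dot x y; lra.
Qed.

(** The form in which the Cauchy-Schwarz inequality is used below: one factor
    [enorm x] can be cancelled, except when it vanishes. *)
Lemma enorm_le_of_dot n (x : 'rV[R]_n) a :
  dot x x <= a * enorm x -> enorm x <= a \/ enorm x = 0.
Proof.
have [->|x0] := eqVneq (enorm x) 0; first by right.
rewrite -enorm_sq expr2 ler_pM2r; first by left.
by rewrite lt_def x0 enorm_ge0.
Qed.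

(** This is where the constant [sqrt D] of the error bounds comes from: the
    approximation hypotheses are stated in the sup norm. *)
Lemma enorm_le_sup n (x : 'rV[R]_n) : enorm x <= Num.sqrt n%:R * `|x|.
Proof.
have h : dot x x <= n%:R * `|x| ^+ 2.
  rewrite -[n in n%:R]card_ord -sum1_card natr_sum mulr_suml.
  apply: ler_sum => i _; rewrite mul1r -expr2 -real_normK ?num_real//.
  rewrite ler_pXn2r ?nnegrE//.
  rewrite [leRHS]/Num.Def.normr /= mx_normrE.
  exact: (le_bigmax _ (fun ij => `|x ij.1 ij.2|) (0, i)).
rewrite -[`|x|]ger0_norm// -sqrtr_sqr -sqrtrM ?ler0n//.
by rewrite ler_wsqrtr.
Qed.

(** The least singular value is at least 1. *)
Definition expanding d D (A : 'M[R]_(d, D)) : Prop :=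
  forall v : 'rV[R]_d, enorm v <= enorm (v *m A).

(** The spectral norm of [M] is at most [a]. *)
Definition opbound d D (M : 'M[R]_(d, D)) (a : R) : Prop :=
  forall v : 'rV[R]_d, enorm (v *m M) <= a * enorm v.

(** The orthogonal projection onto the row space of [A] when the Gram matrix
    is invertible, in the normal-equation form in which [gradt] is defined. *)
Definition rowproj d D (A : 'M[R]_(d, D)) (x : 'rV[R]_D) : 'rV[R]_D :=
  x *m A^T *m invmx (A *m A^T) *m A.

Lemma enorm_frame_coord d D (F : 'M[R]_(d, D)) (y : 'rV[R]_D) :
  F *m F^T = 1%:M -> enorm (y *m F^T) <= enorm y.
Proof.
move=> FF; set c := y *m F^T.
have cF : enorm (c *m F) = enorm c.
  by rewrite /enorm dot_mulmx -mulmxA FF mulmx1.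
have : dot c c <= enorm y * enorm c.
  rewrite -[in leRHS]cF -[X in dot _ X]/(y *m F^T) -dot_mulmx dotC.
  exact: CauchySchwarz_dot.
by move=> /enorm_le_of_dot[//|->]; exact: enorm_ge0.
Qed.

Lemma frame_leq d D (F : 'M[R]_(d, D)) : F *m F^T = 1%:M -> (d <= D)%N.
Proof.
move=> FF; have /eqP <- : row_free F by apply/row_freeP; exists F^T.
exact: rank_leq_col.
Qed.

(** A matrix whose rows project along a frame onto the coordinate vectors is
    the matrix of a graph over that frame, and passing to the graph cannot
    shorten a vector. *)
Lemma graph_expanding d D (F A : 'M[R]_(d, D)) :
  F *m F^T = 1%:M -> A *m F^T = 1%:M -> expanding A.
Proof.
move=> FF AF v; rewrite -[v in leLHS]mulmx1 -AF mulmxA.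
exact: enorm_frame_coord.
Qed.

Lemma expanding_gram_unit d D (A : 'M[R]_(d, D)) :
  expanding A -> A *m A^T \in unitmx.
Proof.
move=> eA; rewrite -row_free_unit -kermx_eq0; apply/eqP/row_matrixP => i.
rewrite row0; set v := row i _.
have vAA : v *m (A *m A^T) = 0 by rewrite /v -row_mul mulmx_ker row0.
have vA0 : enorm (v *m A) = 0.
  by rewrite /enorm dot_mulmx -mulmxA vAA dotC -(scale0r 0) dotZl mul0r sqrtr0.
apply: enorm_eq0; apply/eqP; rewrite eq_le enorm_ge0 andbT.
by rewrite -vA0; exact: eA.
Qed.

(** With [c] the coordinates of the lifted vector, [|c A|^2] is the inner
    product of [w] and [c], and [|c|] is at most [|c A|]. *)
Lemma expanding_pinv_le d D (A : 'M[R]_(d, D)) (w : 'rV[R]_d) :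
  expanding A -> enorm (w *m invmx (A *m A^T) *m A) <= enorm w.
Proof.
move=> eA; set c := w *m _.
have : dot (c *m A) (c *m A) <= enorm w * enorm (c *m A).
  rewrite dot_mulmx -mulmxA [X in dot _ X]mulmxKV ?expanding_gram_unit// dotC.
  exact: le_trans (CauchySchwarz_dot _ _) (ler_wpM2l (enorm_ge0 _) (eA _)).
by move=> /enorm_le_of_dot[//|->]; exact: enorm_ge0.
Qed.

Lemma rowproj_orthogonal d D (A : 'M[R]_(d, D)) (x : 'rV[R]_D) (c : 'rV[R]_d) :
  expanding A -> dot (x - rowproj A x) (c *m A) = 0.
Proof.
move=> eA; rewrite dotC dot_mulmx mulmxBl -[rowproj A x *m _]mulmxA.
rewrite mulmxKV ?expanding_gram_unit// subrr.
by rewrite dotC -(scale0r 0) dotZl mul0r.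
Qed.

Lemma enorm_rowproj_compl d D (A : 'M[R]_(d, D)) (x : 'rV[R]_D) :
  expanding A -> enorm (x - rowproj A x) <= enorm x.
Proof.
move=> eA; set y := x - _.
have : dot y y <= enorm x * enorm y.
  rewrite -[X in dot _ X]/(x - rowproj A x) dotBr.
  by rewrite rowproj_orthogonal// subr0 mulrC CauchySchwarz_dot.
by move=> /enorm_le_of_dot[//|->]; exact: enorm_ge0.
Qed.

Lemma oproj_rows d D (A : 'M[R]_(d, D)) (x : 'rV[R]_D) : expanding A ->
  oproj (range (fun c : 'rV[R]_d => c *m A)) x = rowproj A x.
Proof.
move=> eA; apply: xget_unique.
  by split=> [|_ [c _ <-]]; [exists (x *m A^T *m invmx (A *m A^T))|
                             exact: rowproj_orthogonal].
move=> y [[c _ <-] yP].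
apply/eqP; rewrite -subr_eq0; apply/eqP/enorm_eq0.
set e := c - x *m A^T *m invmx (A *m A^T).
have eE : c *m A - rowproj A x = e *m A by rewrite mulmxBl.
rewrite /enorm eE -[X in dot X _]eE.
have -> : c *m A - rowproj A x = (x - rowproj A x) - (x - c *m A).
  by rewrite opprB [RHS]addrC addrA subrK.
by rewrite dotBl rowproj_orthogonal// yP ?subrr ?sqrtr0//; exists e.
Qed.

Lemma opbound_adjoint d D (M : 'M[R]_(d, D)) a (x : 'rV[R]_D) :
  opbound M a -> 0 <= a -> enorm (x *m M^T) <= a * enorm x.
Proof.
move=> bM a0; set y := x *m _.
have : dot y y <= a * enorm x * enorm y.
  rewrite -[X in dot _ X]/(x *m M^T) -dot_mulmx.
  rewrite (le_trans (CauchySchwarz_dot _ _))// mulrAC.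
  by rewrite ler_wpM2r ?enorm_ge0.
by move=> /enorm_le_of_dot[//|->]; rewrite mulr_ge0 ?enorm_ge0.
Qed.

(** A linear map need only be tested on unit vectors. *)
Lemma opbound_of_sup d D (M : 'M[R]_(d, D)) b :
  (forall v : 'rV[R]_d, enorm v = 1 -> `|v *m M| <= b) ->
  opbound M (Num.sqrt D%:R * b).
Proof.
move=> bM v; have [v0|v0] := eqVneq (enorm v) 0.
  by rewrite v0 (enorm_eq0 v0) mul0mx enorm0 mulr0.
have vp : 0 < enorm v by rewrite lt_def v0 enorm_ge0.
set u := (enorm v)^-1 *: v; have vE : v = enorm v *: u.
  by rewrite scalerA divff// scale1r.
have u1 : enorm u = 1.
  by rewrite enormZ ger0_norm ?invr_ge0 ?enorm_ge0// mulVf.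
have -> : v *m M = enorm v *: (u *m M) by rewrite scalemxAl -vE.
rewrite enormZ ger0_norm ?enorm_ge0// mulrC ler_pM2r//.
rewrite (le_trans (enorm_le_sup _))// ler_wpM2l ?sqrtr_ge0//.
exact: bM.
Qed.

(** Up to the small vector [c *m (A - C)], the vector [z = c *m C] lies in the
    row space of [A], to which [x - rowproj A x] is orthogonal.  Testing against
    vectors of a single row space takes the place of a bound on the difference
    of the two projectors. *)
Lemma rowproj_gap d D (A C : 'M[R]_(d, D)) a (x z : 'rV[R]_D) :
  expanding A -> expanding C -> opbound (A - C) a -> 0 <= a ->
  range (fun c : 'rV[R]_d => c *m C) z ->
  `|dot (x - rowproj A x) z| <= a * enorm x * enorm z.
Proof.
move=> eA eC bAC a0 [c _ <-].
have zE : c *m C = c *m A - c *m (A - C) by rewrite mulmxBr opprB addrC subrK.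
rewrite [X in dot _ X]zE dotBr rowproj_orthogonal// sub0r normrN.
rewrite (le_trans (ler_norm_dot _ _))// (mulrC a) -mulrA.
rewrite ler_pM ?enorm_ge0 ?enorm_rowproj_compl//.
by rewrite (le_trans (bAC _))// ler_wpM2l.
Qed.

(** Here [w] is an approximation of the gradient [x *m B^T] in a chart with
    Jacobian [B], and it is lifted with the approximate Jacobian [A].  Since
    the pseudo-inverse of [A] is a contraction, the error is that of the
    coordinates, and replacing [x *m A^T] by [x *m B^T] costs [a * enorm x]. *)
Lemma lift_error d D (A B : 'M[R]_(d, D)) a (x : 'rV[R]_D) (w : 'rV[R]_d) :
  expanding A -> opbound (A - B) a -> 0 <= a ->
  enorm (w *m invmx (A *m A^T) *m A - rowproj A x)
    <= enorm (w - x *m B^T) + a * enorm x.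
Proof.
move=> eA bAB a0; rewrite -!mulmxBl (le_trans (expanding_pinv_le _ eA))//.
have -> : w - x *m A^T = (w - x *m B^T) - x *m (A - B)^T.
  by rewrite linearB/= mulmxBr opprB addrA subrK.
rewrite (le_trans (ler_enormD _ _))// enormN lerD2l.
exact: opbound_adjoint.
Qed.

Lemma rowproj_norm_le d D (A B : 'M[R]_(d, D)) a (x : 'rV[R]_D) :
  expanding A -> expanding B -> opbound (A - B) a -> 0 <= a ->
  enorm (rowproj B x) <= enorm (rowproj A x) + a * enorm x.
Proof.
move=> eA eB bAB a0; set u := rowproj B x.
have uB : range (fun c : 'rV[R]_d => c *m B) u.
  by exists (x *m B^T *m invmx (B *m B^T)).
have : dot u u <= (enorm (rowproj A x) + a * enorm x) * enorm u.
  have -> : dot u u = dot x u.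
    apply/eqP; rewrite eq_sym -subr_eq0 -dotBl; apply/eqP.
    exact: (rowproj_orthogonal _ (x *m B^T *m invmx (B *m B^T)) eB).
  rewrite -[X in dot X u](subrK (rowproj A x)) dotDl mulrDl addrC lerD//.
    exact: CauchySchwarz_dot.
  by apply: le_trans (ler_norm _) _; exact: (rowproj_gap _ eA eB).
move=> /enorm_le_of_dot[//|->].
by rewrite addr_ge0 ?mulr_ge0 ?enorm_ge0.
Qed.

End Euclid.

(** * Derivatives of maps between spaces of row vectors *)

Section Calculus.
Context {R : realType}.
Implicit Types (n D d : nat).

(** The map is the sum over [j] of its coordinates times the basis vectors. *)
Lemma differentiable_row (V : normedModType R) n (f : V -> 'rV[R]_n) x :
  (forall j, differentiable (fun y => f y 0 j) x) -> differentiable f x.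
Proof.
move=> df.
have -> : f = \sum_(j < n) (fun y => f y 0 j *: delta_mx 0 j).
  by apply/funext => y; rewrite fct_sumE [LHS]row_sum_delta.
by apply: differentiable_sum => j; exact: differentiableZl.
Qed.

Lemma differentiable_big_add (V : normedModType R) I (r : seq I) (P : pred I)
    (f : I -> V -> R) x : (forall i, P i -> differentiable (f i) x) ->
  differentiable (fun y => \sum_(i <- r | P i) f i y) x.
Proof.
move=> df; elim: r => [|i r IHr].
  by under eq_fun do rewrite big_nil; exact: differentiable_cst.
under eq_fun do rewrite big_cons.
case Pi: (P i) => //; apply: (@differentiableD _ _ _ (f i)) => //; exact: df.
Qed.

Lemma differentiable_big_mul (V : normedModType R) I (r : seq I) (P : pred I)
    (f : I -> V -> R) x : (forall i, P i -> differentiable (f i) x) ->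
  differentiable (fun y => \prod_(i <- r | P i) f i y) x.
Proof.
move=> df; elim: r => [|i r IHr].
  by under eq_fun do rewrite big_nil; exact: differentiable_cst.
under eq_fun do rewrite big_cons.
case Pi: (P i) => //; apply: (@differentiableM _ _ (f i)) => //; exact: df.
Qed.

Lemma differentiable_exp (V : normedModType R) (f : V -> R) k x :
  differentiable f x -> differentiable (fun y => f y ^+ k) x.
Proof.
move=> df; elim: k => [|k IHk].
  by under eq_fun do rewrite expr0; exact: differentiable_cst.
by under eq_fun do rewrite exprS; exact: (@differentiableM _ _ f).
Qed.

Lemma differentiable_mulmxr n k (M : 'M[R]_(n, k)) (x : 'rV[R]_n) :
  differentiable (mulmxr M : 'rV[R]_n -> 'rV[R]_k) x.
Proof.
apply: differentiable_row => j /=; under eq_fun do rewrite mxE.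
apply: differentiable_big_add => i _.
by apply: (@differentiableM _ _ (fun y : 'rV[R]_n => y 0 i)) => //;
   exact: differentiable_coord.
Qed.

Lemma diff_mulmxr n k (M : 'M[R]_(n, k)) (x v : 'rV[R]_n) :
  'd (mulmxr M : 'rV[R]_n -> 'rV[R]_k) x v = v *m M.
Proof.
rewrite diff_lin// => y.
exact: differentiable_continuous (differentiable_mulmxr M y).
Qed.

Lemma diffEjacobian n k (f : 'rV[R]_n -> 'rV[R]_k) x v :
  'd f x v = v *m 'J f x.
Proof. by rewrite mul_rV_lin1. Qed.

Lemma polymap_differentiable m d D (g : 'rV[R]_d -> 'rV[R]_D) x :
  polymap m g -> differentiable g x.
Proof.
move=> pg; apply: differentiable_row => j; have [c cE] := pg j.
under eq_fun do rewrite cE.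
apply: differentiable_big_add => a _.
apply: (@differentiableM _ _ (cst (c a))); first exact: differentiable_cst.
apply: differentiable_big_mul => i _; apply: differentiable_exp.
exact: differentiable_coord.
Qed.

Lemma diff_dot_gradient n (f : 'rV[R]_n -> R) x v :
  differentiable f x -> 'd f x v = dot (gradient f x) v.
Proof.
move=> df; rewrite [v in LHS]row_sum_delta linear_sum/=.
by apply: eq_bigr => j _; rewrite linearZ/= mxE deriveE// mulrC.
Qed.

Lemma gradient_comp n k (f : 'rV[R]_k -> R) (psi : 'rV[R]_n -> 'rV[R]_k) u :
  differentiable psi u -> differentiable f (psi u) ->
  gradient (f \o psi) u = gradient f (psi u) *m ('J psi u)^T.
Proof.
move=> dpsi df; apply/rowP => j; rewrite mxE deriveE; last first.
  exact: differentiable_comp.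
rewrite diff_comp//= diff_dot_gradient// diffEjacobian dotC dot_mulmx.
rewrite /dot (bigD1 j)//= big1 => [|i ij].
  by rewrite mxE !eqxx mul1r addr0.
by rewrite [in X in X * _]mxE (negPf ij) andbF mul0r.
Qed.

Lemma is_derive_comp_curve (V W : normedModType R) (g : V -> W) (c : R -> V)
    (t : R) (w : V) :
  is_derive t 1 c w -> differentiable g (c t) ->
  is_derive t 1 (g \o c) ('d g (c t) w).
Proof.
move=> cw dg.
have dc : differentiable c t by apply/derivable1_diffP; exact: ex_derive.
have dgc : differentiable (g \o c) t by exact: differentiable_comp.
apply: DeriveDef; first exact: diff_derivable.
by rewrite deriveE// diff_comp//= -(deriveE _ dc) derive_val.
Qed.

Lemma near_enorm_lt n (rho : R) : 0 < rho ->
  \forall u \near (0 : 'rV[R]_n), enorm u < rho.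
Proof.
move=> rho0; pose s : R := Num.sqrt n%:R.
have s1 : 0 < s + 1 by rewrite ltr_wpDl ?sqrtr_ge0.
near=> u; apply: le_lt_trans (enorm_le_sup u) _.
have : `|u| < rho / (s + 1).
  near: u; apply: (@nbhs0_lt R 'rV[R]_n); exact: divr_gt0.
rewrite ltr_pdivlMr// => h; apply: le_lt_trans h.
by rewrite mulrC ler_wpM2l// lerDl.
Unshelve. all: end_near. Qed.

Lemma is_derive_scale_curve (V : normedModType R) (v : V) (t : R) :
  is_derive t 1 (fun t => t *: v) v.
Proof.
have dk : differentiable (id : R -> R) t by [].
have dkv := differentiableZl v dk.
apply: DeriveDef; first exact: diff_derivable.
by rewrite deriveE// (diffZl v dk) /= diff_val scale1r.
Qed.

End Calculus.

(** * Polynomial maps, local parametrizations and the graph property *)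

Section Polynomials.
Context {R : realType}.
Implicit Types (m d D : nat).

Lemma polyfunD m d (p q : 'rV[R]_d -> R) :
  polyfun m p -> polyfun m q -> polyfun m (fun x => p x + q x).
Proof.
move=> [c pc] [e qe]; exists (fun a => c a + e a) => x.
by rewrite pc qe -big_split; apply: eq_bigr => a _; rewrite mulrDl.
Qed.

Lemma polyfunZ m d (p : 'rV[R]_d -> R) b :
  polyfun m p -> polyfun m (fun x => b * p x).
Proof.
move=> [c pc]; exists (fun a => b * c a) => x.
by rewrite pc mulr_sumr; apply: eq_bigr => a _; rewrite mulrA.
Qed.

Lemma polyfun_cst m d b : polyfun m (fun _ : 'rV[R]_d => b).
Proof.
pose a0 : {ffun 'I_d -> 'I_m.+1} := [ffun => ord0].
exists (fun a => if a == a0 then b else 0) => x.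
rewrite (bigD1 a0) /=; last first.
  by rewrite big1// => i _; rewrite ffunE.
rewrite eqxx [X in _ * X]big1 => [|i _]; last by rewrite ffunE expr0.
rewrite mulr1 big1 ?addr0// => a /andP[_ /negPf ->].
by rewrite mul0r.
Qed.

Lemma polyfun_coord m d (i : 'I_d) :
  (0 < m)%N -> polyfun m (fun x : 'rV[R]_d => x 0 i).
Proof.
move=> m0; pose a1 : {ffun 'I_d -> 'I_m.+1} :=
  [ffun j => if j == i then inord 1 else ord0].
have a1i : a1 i = 1%N :> nat by rewrite ffunE eqxx inordK.
have a1j j : j != i -> a1 j = 0%N :> nat by rewrite ffunE => /negPf ->.
exists (fun a => (a == a1)%:R) => x.
rewrite (bigD1 a1) /=; last first.
  by rewrite (bigD1 i)//= a1i big1 => [|j /a1j//]; rewrite addn0.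
rewrite eqxx mul1r (bigD1 i)//= a1i expr1.
rewrite [X in _ * X]big1 => [|j /a1j ->]; last by rewrite expr0.
rewrite mulr1 big1 ?addr0// => a /andP[_ /negPf ->].
by rewrite mul0r.
Qed.

Lemma polyfun_sum m d (I : Type) (r : seq I) (p : I -> 'rV[R]_d -> R) :
  (forall i, polyfun m (p i)) -> polyfun m (fun x => \sum_(i <- r) p i x).
Proof.
move=> pp; elim: r => [|i r IHr].
  by under eq_fun do rewrite big_nil; exact: polyfun_cst.
by under eq_fun do rewrite big_cons; exact: polyfunD.
Qed.

Lemma polymap_mulmxr m d n k (g : 'rV[R]_d -> 'rV[R]_n) (M : 'M[R]_(n, k)) :
  polymap m g -> polymap m (fun x => g x *m M).
Proof.
move=> pg j; under eq_fun do rewrite mxE.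
apply: polyfun_sum => i; under eq_fun do rewrite mulrC.
exact: polyfunZ.
Qed.

Lemma polymapB m d n (f g : 'rV[R]_d -> 'rV[R]_n) :
  polymap m f -> polymap m g -> polymap m (fun x => f x - g x).
Proof.
move=> pf pg j; under eq_fun do rewrite !mxE -mulN1r.
by apply: polyfunD => //; exact: polyfunZ.
Qed.

Lemma polymap_cst m d n (b : 'rV[R]_n) : polymap m (fun _ : 'rV[R]_d => b).
Proof. by move=> j; exact: polyfun_cst. Qed.

Lemma polymap_id m d : (0 < m)%N -> polymap m (fun x : 'rV[R]_d => x).
Proof. by move=> m0 j; exact: polyfun_coord. Qed.

End Polynomials.

(** The derivative of the identity, computed through [psi]. *)
Lemma jacobian_right_inverse (R : realType) D d (F : 'M[R]_(d, D))
    (psi : 'rV[R]_d -> 'rV[R]_D) (q : 'rV[R]_D) :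
  differentiable psi 0 ->
  (\forall u \near (0 : 'rV[R]_d), (psi u - q) *m F^T = u) ->
  'J psi 0 *m F^T = 1%:M.
Proof.
move=> dpsi psiK.
apply/row_matrixP => i; rewrite !rowE mulmx1; set v := delta_mx 0 i.
rewrite mulmxA -diffEjacobian -(diff_mulmxr _ (psi 0)).
have dF := differentiable_mulmxr F^T (psi 0).
rewrite -[LHS]/(('d (mulmxr F^T : 'rV[R]_D -> 'rV[R]_d) (psi 0) \o 'd psi 0) v).
rewrite -diff_comp// -deriveE; last exact: differentiable_comp.
have -> : 'D_v (mulmxr F^T \o psi) 0
        = 'D_v (fun u : 'rV[R]_d => u + q *m F^T) 0.
  apply: near_eq_derive; apply: filterS psiK => u psiu.
  by rewrite -[in RHS]psiu mulmxBl subrK.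
rewrite (@deriveD _ _ _ id (cst (q *m F^T)))//.
by rewrite derive_id derive_cst addr0.
Qed.

Section LocalParam.
Context {R : realType} {D d : nat} (pb : problem R D d).
Context (man : 'rV[R]_D -> Prop) (A : set 'rV[R]_D) (rho : R) (q a : 'rV[R]_D)
  (H : {vspace 'rV[R]_D}) (psi : 'rV[R]_d -> 'rV[R]_D).
Hypotheses (rho_gt0 : 0 < rho) (psiP : local_param pb man A rho q H a psi)
  (mana : man a).
Let F := frame pb H.

Lemma local_param_diff : differentiable psi 0.
Proof.
have [psi0 psiu] := psiP; have [|_ _ _ + _] := psiu 0.
  by rewrite enorm0.
by rewrite psi0; exact.
Qed.

Lemma local_param_jacobian_frame : 'J psi 0 *m F^T = 1%:M.
Proof.
apply: (jacobian_right_inverse (q := q)); first exact: local_param_diff.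
near=> u; have [_ psiu] := psiP; have [|//] := psiu u.
by near: u; exact: near_enorm_lt.
Unshelve. all: end_near. Qed.

(** A curve in [A] through [a] is the image under [psi] of its own
    coordinates, so its velocity lies in the range of the differential; the
    converse follows from the images of lines. *)
Lemma tangent_local_param :
  tangent A a = range (fun c : 'rV[R]_d => c *m 'J psi 0).
Proof.
have dpsi := local_param_diff; have [psi0 psiu] := psiP.
have [|_ cu0 _ _ inv] := psiu 0; first by rewrite enorm0.
apply/seteqP; split => [w [c [c0 Ac cw]]|_ [v _ <-]].
  exists (w *m F^T) => //=; rewrite -diffEjacobian.
  have dc : differentiable c 0 by apply/derivable1_diffP; exact: ex_derive.
  (* The coordinates of the curve, whose velocity at time 0 is w *m F^T. *)
  pose e := mulmxr F^T \o (c \- cst q).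
  have ecw : is_derive (0 : R) 1 e (w *m F^T).
    rewrite -(diff_mulmxr F^T (c 0 - q)).
    apply: is_derive_comp_curve; last exact: differentiable_mulmxr.
    by rewrite -[w]subr0; exact: is_deriveB.
  have e0 : e 0 = 0 by rewrite /e/= c0 -psi0; exact: cu0.
  have pe : is_derive (0 : R) 1 (psi \o e) ('d psi 0 (w *m F^T)).
    rewrite -[X in 'd psi X]e0.
    by apply: is_derive_comp_curve => //; rewrite e0.
  have : is_derive (0 : R) 1 c ('d psi 0 (w *m F^T)).
    apply: near_eq_is_derive pe.
    have cc : {for 0, continuous c} by exact: differentiable_continuous.
    move: inv; rewrite psi0 -c0 => /cc.
    by apply: filterS2 Ac => t Act; exact.
  by case=> _ <-; rewrite derive_val.
exists (fun t => psi (t *: v)); split.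
- by rewrite scale0r.
- have cv : {for 0, continuous (fun t : R => t *: v)}.
    by apply: differentiable_continuous; apply/derivable1_diffP;
       exact: (@ex_derive _ _ _ _ _ _ _ (is_derive_scale_curve v 0)).
  have : \forall u \near (0 *: v), enorm u < rho.
    by rewrite scale0r; exact: near_enorm_lt.
  move=> /cv cvrho; near=> t; have [|//] := psiu (t *: v).
  by near: t.
- rewrite -diffEjacobian -[X in 'd psi X](scale0r v).
  apply: (is_derive_comp_curve (is_derive_scale_curve v 0)).
  by rewrite scale0r.
Unshelve. all: end_near. Qed.

End LocalParam.

Lemma manif_Uunique (R : realType) D d (pb : problem R D d) (s : mmls R D d) p :
  mmls_spec pb s -> manif pb p -> Uunique pb s p.
Proof.
move=> hs Mp; have [e e0 tu] := unique_nbhd hs.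
by exists e; split => //; exists p => //; rewrite subrr enorm0.
Qed.

Lemma Hsp_frame (R : realType) D d (pb : problem R D d) (s : mmls R D d) p :
  problem_spec pb -> mmls_spec pb s -> manif pb p ->
  frame pb (Hsp s p) *m (frame pb (Hsp s p))^T = 1%:M.
Proof.
move=> hpb hs Mp; have [[dimH _ _ _] _] := step1P hs (manif_Uunique hs Mp).
by have [] := frameP hpb dimH.
Qed.

(** Removing from the minimizer of Step 2 the error of its component along [H]
    leaves a polynomial map of degree at most [degree pb], which is at least 1,
    and does not increase any residual, because the projection of a sample on
    [H] is exactly the node at which its residual is taken.  Uniqueness of the
    minimizer then says that there was no such error. *)
Lemma gstar_coord (R : realType) D d (pb : problem R D d) (s : mmls R D d) p u :
  problem_spec pb -> mmls_spec pb s -> manif pb p ->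
  Defs.coord pb (Hsp s p) (gstar s p u - qpt s p) = u.
Proof.
move=> hpb hs Mp; have FF := Hsp_frame hpb hs Mp.
have [[pg gmin] guniq] := step2P hs (manif_Uunique hs Mp).
rewrite /Defs.coord; set F := frame pb _ in FF *.
set g := gstar s p in pg gmin guniq *.
set q := qpt s p.
(* g with its H-component replaced by the identity. *)
pose g' x := g x - ((g x - q) *m F^T - x) *m F.
have g'min : step2_min pb s p g'.
  split=> [|g'' /gmin]; last first.
    apply: le_trans; apply: lee_sum => i _; apply: lee_wpmul2r.
      by have [[theta_ge0 _] _] := thetahP hs.
    rewrite lee_fin ler_pXn2r ?nnegrE ?enorm_ge0//.
    rewrite /Defs.coord -/F -/q; set x := sample i; set y := g _.
    set c := _ *m F^T.
    have -> : g' c - x = (y - x) - rowproj F (y - x).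
      rewrite /rowproj FF invmx1 mulmx1 /g' -/y addrAC.
      by rewrite -[c]/((x - q) *m F^T) -mulmxBl opprB addrA subrK.
    apply: enorm_rowproj_compl => v.
    by rewrite /enorm dot_mulmx -mulmxA FF mulmx1.
  apply: polymapB => //; apply: polymap_mulmxr; apply: polymapB.
    apply: polymap_mulmxr; apply: polymapB => //; exact: polymap_cst.
  exact/polymap_id/(degree_gt0 hpb).
have /(congr1 (fun f => f u)) := guniq _ g'min.
rewrite /g' => /eqP; rewrite -subr_eq0 addrAC subrr sub0r oppr_eq0 => /eqP.
move=> /(congr1 (mulmx^~ F^T)); rewrite -mulmxA FF mulmx1 mul0mx.
by move=> /eqP; rewrite subr_eq0 => /eqP.
Qed.

(** * Error of the approximate gradient *)

Section Approximation.
Context {R : realType} {D d : nat} (pb : problem R D d) (s : mmls R D d).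
Hypotheses (hpb : problem_spec pb) (hs : mmls_spec pb s).
Context (p : 'rV[R]_D).
Hypothesis (Mp : manif pb p).
Let F := frame pb (Hsp s p).
Let h := hfill s.
Let m := degree pb.
Let dm := Num.sqrt (D%:R : R) * h ^+ m.
Let A := Dg0 s p.
Let B := 'J (phi s p) 0.
Let C := 'J (phit s p) 0.
Let g := gradient (cost pb) p.

Local Lemma frame_orthonormal : F *m F^T = 1%:M.
Proof. exact: Hsp_frame hpb hs Mp. Qed.

Local Lemma radius_gt0 : 0 < c_1 pb * h.
Proof.
by rewrite mulr_gt0 ?(h_gt0 hs)// (lt_trans _ (c_1_gt3 hpb)).
Qed.

Local Lemma zero_in_ball : enorm (0 : 'rV[R]_d) < c_1 pb * h.
Proof. by rewrite enorm0 radius_gt0. Qed.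

Lemma gstar_differentiable u : differentiable (gstar s p) u.
Proof.
have [[pg _] _] := step2P hs (manif_Uunique hs Mp).
exact: polymap_differentiable pg.
Qed.

Lemma Dg0_expanding : expanding A.
Proof.
apply: (graph_expanding frame_orthonormal).
apply: (jacobian_right_inverse (q := qpt s p)).
  exact: gstar_differentiable.
by near=> u; exact: gstar_coord hpb hs Mp.
Unshelve. all: end_near. Qed.

Lemma phi_differentiable : differentiable (phi s p) 0.
Proof. exact: (local_param_diff radius_gt0 (phiP hs Mp)). Qed.

Lemma phi_expanding : expanding B.
Proof.
apply: (graph_expanding frame_orthonormal).
exact: (local_param_jacobian_frame radius_gt0 (phiP hs Mp)).
Qed.

Lemma exists_unit : exists v : 'rV[R]_d, enorm v = 1.
Proof.
exists (delta_mx 0 (Ordinal (dim_gt0 hpb))).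
rewrite /enorm /dot (bigD1 (Ordinal (dim_gt0 hpb)))//= mxE !eqxx mulr1.
rewrite big1 ?addr0 ?sqrtr1// => i ij.
by rewrite mxE (negPf ij) andbF mul0r.
Qed.

Lemma c_M_ge0 : 0 <= c_M pb * h ^+ m.
Proof.
have [v v1] := exists_unit.
exact: le_trans (normr_ge0 _) (c_MP hs Mp zero_in_ball v1).
Qed.

Lemma Dg0_phi_close : opbound (A - B) (c_M pb * dm).
Proof.
rewrite mulrCA; apply: opbound_of_sup => v v1.
have vA : v *m A = 'D_v (gstar s p) 0.
  by rewrite (deriveEjacobian v (gstar_differentiable 0)).
have vB : v *m B = 'D_v (phi s p) 0.
  by rewrite (deriveEjacobian v phi_differentiable).
have -> : v *m (A - B) = 'D_v (gstar s p) 0 - 'D_v (phi s p) 0.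
  by rewrite -vA -vB; exact: mulmxBr.
exact: (c_MP hs Mp zero_in_ball v1).
Qed.

Lemma gradt_at_base :
  gradt s (Pm s p)
    = gradient (pf s (Pm s p)) 0 *m invmx (A *m A^T) *m A.
Proof.
have [_ _ gE _] := Pm_fiber hs Mp (erefl (Pm s p)).
by rewrite /gradt /Dg0 gE.
Qed.

Lemma cost_differentiable x : differentiable (cost pb) x.
Proof. by have [+ _] := cost_C1 hpb [::] (I : setT x); exact. Qed.

(** The lifting estimate at [0], where the exact gradient in the chart of the
    manifold is [g *m B^T] by the chain rule.  The sup norm on [R^d] costs only
    [sqrt d], which is at most [sqrt D] because [R^D] contains a [d]-frame. *)
Lemma gradt_error :
  enorm (gradt s (Pm s p) - rowproj A g) <= (c_f pb + c_M pb * enorm g) * dm.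
Proof.
rewrite gradt_at_base.
have dm_cM : 0 <= c_M pb * dm by rewrite mulrCA mulr_ge0 ?sqrtr_ge0 ?c_M_ge0.
apply: le_trans (lift_error _ _ Dg0_expanding Dg0_phi_close dm_cM) _.
rewrite mulrDl; apply: lerD; last by rewrite mulrAC.
have phi0 : phi s p 0 = p by have [] := phiP hs Mp.
have -> : g *m B^T = gradient (cost pb \o phi s p) 0.
  rewrite gradient_comp ?phi0//; first exact: phi_differentiable.
  exact: cost_differentiable.
apply: le_trans (enorm_le_sup _) _; rewrite mulrCA.
apply: ler_pM => //.
- by rewrite ler_wsqrtr// ler_nat (frame_leq frame_orthonormal).
- exact: (c_fP hs Mp zero_in_ball).
Qed.

Lemma Rgrad_manif : Rgrad (manif pb) (cost pb) p = rowproj B g.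
Proof.
rewrite /Rgrad (tangent_local_param radius_gt0 (phiP hs Mp) I) oproj_rows//.
exact: phi_expanding.
Qed.

(** The second occurrence of [c_M] in the bound is the tilt between the range
    of [A] and the tangent space of the manifold; the first one is already in
    [gradt_error]. *)
Lemma Rgrad_manif_le e : enorm (gradt s (Pm s p)) <= e ->
  enorm (Rgrad (manif pb) (cost pb) p) <= bound_M pb s e.
Proof.
move=> ge; rewrite Rgrad_manif.
have dm_cM : 0 <= c_M pb * dm by rewrite mulrCA mulr_ge0 ?sqrtr_ge0 ?c_M_ge0.
have h1 := rowproj_norm_le g Dg0_expanding phi_expanding Dg0_phi_close dm_cM.
have h2 := gradt_error.
have h3 : enorm (rowproj A g) <= enorm (gradt s (Pm s p))
    + enorm (gradt s (Pm s p) - rowproj A g).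
  rewrite enormC -[X in enorm X <= _](subrK (gradt s (Pm s p))) addrC.
  exact: ler_enormD.
have h4 : c_M pb * dm * enorm g <= c_M pb * dm * Gmax pb.
  by rewrite ler_wpM2l// GmaxP.
rewrite /bound_M -[h in h ^+ _]/h -/m -mulrA -/dm.
apply: le_trans h1 _; apply: le_trans (lerD (le_trans h3 (lerD ge h2)) h4) _.
clear h2 h3; lra.
Qed.

Section AtManifoldPoint.
Hypothesis man_x : Mt_manifold_at pb s (Pm s p).

Local Lemma manifold_at_phit0 : Mt_manifold_at pb s (phit s p 0).
Proof. by have [-> _] := phitP hs Mp. Qed.

Lemma phit_differentiable : differentiable (phit s p) 0.
Proof. exact: (local_param_diff radius_gt0 (phitP hs Mp)). Qed.

Lemma phit_expanding : expanding C.
Proof.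
apply: (graph_expanding frame_orthonormal).
exact: (local_param_jacobian_frame radius_gt0 (phitP hs Mp)).
Qed.

Lemma c_Mt_ge0 : 0 <= c_Mt pb * h ^+ m.
Proof.
have [v v1] := exists_unit.
exact: le_trans (normr_ge0 _) (c_MtP hs Mp zero_in_ball v1 manifold_at_phit0).
Qed.

Lemma Dg0_phit_close : opbound (A - C) (c_Mt pb * dm).
Proof.
rewrite mulrCA; apply: opbound_of_sup => v v1.
have vA : v *m A = 'D_v (gstar s p) 0.
  by rewrite (deriveEjacobian v (gstar_differentiable 0)).
have vC : v *m C = 'D_v (phit s p) 0.
  by rewrite (deriveEjacobian v phit_differentiable).
have -> : v *m (A - C) = 'D_v (gstar s p) 0 - 'D_v (phit s p) 0.
  by rewrite -vA -vC; exact: mulmxBr.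
exact: (c_MtP hs Mp zero_in_ball v1 manifold_at_phit0).
Qed.

Lemma tangent_Mt :
  tangent (Mt pb s) (Pm s p) = range (fun c : 'rV[R]_d => c *m C).
Proof. exact: (tangent_local_param radius_gt0 (phitP hs Mp)). Qed.

(** The two gradients differ by a vector orthogonal to the tangent space. *)
Lemma dot_Rgrad_Mt z : tangent (Mt pb s) (Pm s p) z ->
  dot (Rgrad (Mt pb s) (cost pb) (Pm s p)) z
    = dot (gradient (cost pb) (Pm s p)) z.
Proof.
rewrite /Rgrad tangent_Mt => -[c _ <-].
rewrite oproj_rows; last exact: phit_expanding.
apply/eqP; rewrite eq_sym -subr_eq0 -dotBl rowproj_orthogonal//.
exact: phit_expanding.
Qed.

(** The power [h ^+ m.+1] of the distance from [p] to [Pm s p] loses one factor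
    [h], which pays for the Lipschitz constant since [h * lip <= 1]. *)
Lemma gradient_shift :
  enorm (gradient (cost pb) (Pm s p) - g) <= c_MMLS pb * dm.
Proof.
have hull x : (Mt pb s `|` manif pb) x -> convex_hull (Mt pb s `|` manif pb) x.
  by move=> Sx K _; exact.
have hp : convex_hull (Mt pb s `|` manif pb) p by apply: hull; right.
have hx : convex_hull (Mt pb s `|` manif pb) (Pm s p).
  by apply: hull; left; exists p.
apply: le_trans (cost_lip hs hp hx) _.
apply: le_trans (ler_wpM2l (lip_ge0 hpb) (c_MMLSP hs Mp)) _.
have cdm : 0 <= c_MMLS pb * dm.
  have := le_trans (enorm_ge0 _) (c_MMLSP hs Mp).
  by rewrite exprSr mulrA pmulr_lge0 ?(h_gt0 hs)// -mulrA.
have -> : lip pb * (c_MMLS pb * Num.sqrt D%:R * hfill s ^+ (degree pb).+1)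
        = (h * lip pb) * (c_MMLS pb * dm) by rewrite exprS /dm /h /m; ring.
by rewrite -[leRHS]mul1r ler_wpM2r// (hL_le1 hs).
Qed.

Lemma Ebound_ge0 : 0 <= Ebound pb s p.
Proof.
have cdm : 0 <= c_MMLS pb * dm := le_trans (enorm_ge0 _) gradient_shift.
have cM := mulr_ge0 (sqrtr_ge0 (D%:R : R)) c_M_ge0.
have cMt := mulr_ge0 (sqrtr_ge0 (D%:R : R)) c_Mt_ge0.
have cf : 0 <= c_f pb * h ^+ m.
  exact: le_trans (normr_ge0 _) (c_fP hs Mp zero_in_ball).
have {}cf := mulr_ge0 (sqrtr_ge0 (D%:R : R)) cf.
have := mulr_ge0 cM (enorm_ge0 g); have := mulr_ge0 cMt (enorm_ge0 g).
by rewrite /Ebound -/g -/h -/m; move: cdm cf; rewrite /dm; lra.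
Qed.

(** The error has three sources: the displacement of the base point, the tilt
    of the approximate tangent space, and the lifting of the gradient. *)
Lemma gradt_tangent_error z : tangent (Mt pb s) (Pm s p) z ->
  `|dot (Rgrad (Mt pb s) (cost pb) (Pm s p) - gradt s (Pm s p)) z|
    <= Ebound pb s p * enorm z.
Proof.
move=> Tz; rewrite dotBl dot_Rgrad_Mt// -dotBl.
set y := gradient _ _; set gt := gradt _ _.
have -> : y - gt = (y - g) + (g - rowproj A g) - (gt - rowproj A g).
  by rewrite addrA subrK opprB addrA subrK.
rewrite dotBl dotDl.
have cMt : 0 <= c_Mt pb * dm by rewrite mulrCA mulr_ge0 ?sqrtr_ge0 ?c_Mt_ge0.
have cM : 0 <= c_M pb * dm by rewrite mulrCA mulr_ge0 ?sqrtr_ge0 ?c_M_ge0.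
have h1 : `|dot (y - g) z| <= c_MMLS pb * dm * enorm z.
  apply: le_trans (ler_norm_dot _ _) _.
  by rewrite ler_wpM2r ?enorm_ge0// gradient_shift.
have h2 : `|dot (g - rowproj A g) z| <= c_Mt pb * dm * enorm g * enorm z.
  move: Tz; rewrite tangent_Mt.
  exact: (rowproj_gap _ Dg0_expanding phit_expanding Dg0_phit_close).
have h3 : `|dot (gt - rowproj A g) z|
    <= (c_f pb + c_M pb * enorm g) * dm * enorm z.
  apply: le_trans (ler_norm_dot _ _) _.
  by rewrite ler_wpM2r ?enorm_ge0// gradt_error.
apply: le_trans (ler_normB _ _) _.
apply: le_trans (lerD (le_trans (ler_normD _ _) (lerD h1 h2)) h3) _.
have := mulr_ge0 (mulr_ge0 cM (enorm_ge0 g)) (enorm_ge0 z).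
by rewrite /Ebound -/g -/h -/m /dm; lra.
Qed.

End AtManifoldPoint.
End Approximation.

(** * Decrease of the cost along the approximate retraction *)

Section Descent.
Context {R : realType} {D d : nat} (pb : problem R D d) (s : mmls R D d).
Hypotheses (hpb : problem_spec pb) (hs : mmls_spec pb s).
Context (p : 'rV[R]_D).
Hypotheses (Mp : manif pb p) (man_x : Mt_manifold_at pb s (Pm s p)).
Let x := Pm s p.
Let Q := Qret pb s.
Let gt := gradt s x.

Lemma Tt_scale (y xi : 'rV[R]_D) a : Tt s y xi -> Tt s y (a *: xi).
Proof. by move=> [c _ <-]; exists (a *: c) => //; rewrite scalemxAl. Qed.

Lemma gradt_Tt y : Tt s y (gradt s y).
Proof.
by exists (gradient (pf s y) 0 *m invmx (Dg0 s y *m (Dg0 s y)^T)).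
Qed.

(** Both corrections come from derivatives of the retraction along the same
    ray, run at different speeds, so the chain rule relates them. *)
Lemma vprime_scale xi a : Kdom pb s (x, xi) -> Kdom pb s (x, a *: xi) ->
  vprime s x (a *: xi) = a *: vprime s x xi.
Proof.
move=> K1 K2; have [_ [d1 _]] := vcurveP hs K1 man_x.
have [_ [d2 _]] := vcurveP hs K2 man_x.
pose ray t := Rt s x (t *: xi).
have dray : differentiable ray (0 *: a).
  rewrite scale0r; apply/derivable1_diffP.
  exact: (@ex_derive _ _ _ _ _ _ _ d1).
have d3 := is_derive_comp_curve (is_derive_scale_curve (a : R) 0) dray.
have rayE : (ray \o (fun t : R => t *: a)) = (fun t => Rt s x (t *: (a *: xi))).
  by apply/funext => t; rewrite /ray/= scalerA.
have : 'd ray (0 *: a) a = a *: xi + vprime s x (a *: xi).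
  by case: d3 => _ <-; rewrite rayE; case: d2.
rewrite -[X in 'd ray _ X]mulr1 -[a * 1]/(a *: (1 : R)) linearZ /= -deriveE//.
rewrite scale0r; case: d1 => _ -> => /eqP.
by rewrite scalerDr => /eqP/addrI.
Qed.

Hypothesis hLv : 6 * Lv s <= Q.

(** The bound [Lv] on all of [Kdom] is improved by homogeneity: it is applied
    to the vector of length [Qret] in the direction of [xi], and scaled back. *)
Lemma vprime_le xi : Kdom pb s (x, xi) -> enorm (vprime s x xi) <= enorm xi / 6.
Proof.
move=> K; have Q0 : 0 < Q := Qret_gt0 hs.
have [Mx Tx leQ] := K; rewrite /= in Mx Tx leQ.
have [xi0|xi0] := eqVneq (enorm xi) 0.
  have K' : Kdom pb s (x, 0 *: xi) by rewrite scale0r -(enorm_eq0 xi0).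
  have := vprime_scale K K'; rewrite !scale0r => v0.
  by rewrite (enorm_eq0 xi0) v0 !enorm0 mul0r.
have xip : 0 < enorm xi by rewrite lt_def xi0 enorm_ge0.
(* Stretch xi to the boundary of the domain of the retraction. *)
set a := Q / enorm xi; have a0 : 0 < a by exact: divr_gt0.
have K' : Kdom pb s (x, a *: xi).
  split => //=; first exact: Tt_scale.
  by rewrite enormZ gtr0_norm// divfK.
have := LvP hs K' man_x; rewrite vprime_scale// enormZ gtr0_norm// => h1.
have : a * enorm (vprime s x xi) <= a * (enorm xi / 6).
  rewrite (le_trans h1)// mulrA divfK// -/Q.
  by rewrite ler_pdivlMr// mulrC.
by rewrite ler_pM2l.
Qed.

Hypotheses (gt_gt0 : 0 < enorm gt) (gt_big : 2 * Ebound pb s p <= enorm gt).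

Lemma beta_bounds : 2^-1 <= beta pb s x p <= 1.
Proof.
rewrite /beta -/gt; apply/andP; split; last first.
  by rewrite gerBl divr_ge0 ?enorm_ge0// (Ebound_ge0 hpb hs Mp man_x).
have : Ebound pb s p / enorm gt <= 2^-1 by rewrite ler_pdivrMr// ler_pdivlMl.
lra.
Qed.

(** Let [a = alpha * enorm gt] be the length of the step and
    [z = xi + vprime].  As [enorm vprime <= a / 6], the first-order term is at
    most [- a * enorm gt + enorm gt * a / 6 + E * (7 / 6 * a)], with [E] the
    error bound.  Since [E <= enorm gt / 2], this is at most
    [- a * (enorm gt - E) / 2], which is
    [- beta / 2 * alpha * enorm gt ^+ 2]. *)
Lemma descent alpha : 0 <= alpha -> alpha * enorm gt <= Q ->
  beta pb s x p / 2 * alpha * enorm gt ^+ 2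
    - Ltil s / 2 * (alpha * enorm gt) ^+ 2
  <= cost pb x - cost pb (Rt s x (- (alpha *: gt))).
Proof.
move=> alpha0 leQ; set xi := - (alpha *: gt).
have xiE : enorm xi = alpha * enorm gt by rewrite enormN enormZ ger0_norm.
have K : Kdom pb s (x, xi).
  split => /=; first by exists p.
    by rewrite /xi -scaleNr; apply: Tt_scale; exact: gradt_Tt.
  by rewrite xiE.
have [_ [_ Tz]] := vcurveP hs K man_x.
have lip := LtilP hs K man_x.
have err := gradt_tangent_error hpb hs Mp man_x Tz.
have vle := vprime_le K; rewrite xiE in lip vle.
set z := xi + _ in Tz lip err.
have zle : enorm z <= 7 / 6 * (alpha * enorm gt).
  apply: le_trans (ler_enormD _ _) _; rewrite xiE; lra.
have E0 := Ebound_ge0 hpb hs Mp man_x.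
have Ez := ler_wpM2l E0 zle.
have gtz : dot gt z <= - (alpha * enorm gt ^+ 2)
    + enorm gt * (alpha * enorm gt / 6).
  have -> : z = (- alpha) *: gt + vprime s x xi by rewrite scaleNr.
  rewrite dotDr dotZr -enorm_sq mulNr lerD2l.
  apply: le_trans (CauchySchwarz_dot _ _) _.
  by rewrite ler_wpM2l ?enorm_ge0.
move: lip err; rewrite dotBl -/gt !ler_norml => /andP[_ lip] /andP[_ err].
have aE : alpha * Ebound pb s p * enorm gt <= alpha * enorm gt ^+ 2 / 2.
  have := ler_wpM2l alpha0 (ler_wpM2r (enorm_ge0 gt) gt_big).
  by move: (Ebound pb s p) => E; lra.
have -> : beta pb s x p / 2 * alpha * enorm gt ^+ 2
    = alpha * enorm gt ^+ 2 / 2 - alpha * Ebound pb s p * enorm gt / 2.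
  by rewrite /beta -/gt; field; rewrite gt_eqF.
move: lip err gtz Ez aE; lra.
Qed.

Lemma sufficient_decrease delta alpha : 0 <= alpha -> alpha * enorm gt <= Q ->
  alpha <= 2 * (beta pb s x p / 2 - delta) / Ltil s ->
  ~ insufficient pb s delta alpha x.
Proof.
move=> alpha0 leQ ale; rewrite /insufficient -/gt; apply/negP; rewrite -leNgt.
apply: le_trans (descent alpha0 leQ).
move: ale; rewrite ler_pdivlMr ?(Ltil_gt0 hs)// => ale.
have := ler_wpM2r (mulr_ge0 alpha0 (sqr_ge0 (enorm gt))) ale.
by rewrite exprMn; lra.
Qed.

End Descent.

(** * Backtracking *)

Section Backtracking.
Context {R : realType} {D d : nat} (pb : problem R D d) (s : mmls R D d).
Context (gamma delta a0 safe : R) (x : 'rV[R]_D).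
Hypotheses (hgamma : 0 < gamma < 1) (a0_gt0 : 0 < a0) (safe_gt0 : 0 < safe).
Hypothesis (short_ok : forall a, 0 <= a -> a <= a0 -> a <= safe ->
  ~ insufficient pb s delta a x).

Local Lemma gamma_pow_gt0 k : 0 < gamma ^+ k.
Proof. by have [g0 _] := andP hgamma; exact: exprn_gt0. Qed.

Local Lemma gamma_pow_le1 k : gamma ^+ k <= 1.
Proof. by have [g0 /ltW g1] := andP hgamma; rewrite exprn_ile1// ltW. Qed.

Lemma backtracks_exists : exists k, backtracks pb s gamma delta a0 x k.
Proof.
have [g0 g1] := andP hgamma.
have [n gn] : exists n, gamma ^+ n * a0 <= safe.
  have g_to0 : gamma ^+ n @[n --> \oo] --> (0 : R).
    by apply: cvg_expr; rewrite gtr0_norm.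
  have := (cvgrPdist_lt _ _).1 g_to0 (safe / a0) (divr_gt0 safe_gt0 a0_gt0).
  move=> [n _ /(_ n (leqnn n))].
  rewrite /= sub0r normrN gtr0_norm ?gamma_pow_gt0//.
  by rewrite ltr_pdivlMr// => /ltW; exists n.
have exP : exists n, `[< ~ insufficient pb s delta (gamma ^+ n * a0) x >].
  exists n; apply/asboolP; apply: short_ok => //.
    by rewrite mulr_ge0 ?ltW// gamma_pow_gt0.
  by rewrite ger_pMl// gamma_pow_le1.
case: (ex_minnP exP) => k /asboolP Pk kmin; exists k; split => // j jk.
apply: contrapT => /asboolP/kmin; by rewrite leqNgt jk.
Qed.

Lemma backtracks_reject k : backtracks pb s gamma delta a0 x k.+1 ->
  safe < gamma ^+ k * a0.
Proof.
move=> [rej _]; rewrite ltNge; apply/negP => le_c.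
apply: short_ok le_c (rej k (ltnSn k)).
  by rewrite mulr_ge0 ?ltW// gamma_pow_gt0.
by rewrite ger_pMl// gamma_pow_le1.
Qed.

(** Either the first step is accepted, or the step before the accepted one was
    rejected, hence longer than [safe]. *)
Lemma backtracks_step_ge k : backtracks pb s gamma delta a0 x k ->
  Num.min a0 (gamma * safe) <= gamma ^+ k * a0.
Proof.
case: k => [|k bk]; first by rewrite expr0 mul1r ge_min lexx.
have [g0 _] := andP hgamma.
by rewrite ge_min exprS -mulrA ler_pM2l// (ltW (backtracks_reject bk)) orbT.
Qed.

(** The last rejected step [gamma ^+ k * a0] is longer than [safe]; taking
    logarithms bounds the number of reductions. *)
Lemma backtracks_count k : backtracks pb s gamma delta a0 x k ->
  k.+1%:R <= Num.max 1 (2 + ln (a0 / (gamma * safe)) / ln gamma^-1).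
Proof.
case: k => [|k bk]; first by rewrite le_max lexx.
have [g0 g1] := andP hgamma; rewrite le_max; apply/orP; right.
have lng : 0 < ln gamma^-1 by rewrite ln_gt0// invf_gt1.
have Xgt : gamma^-1 ^+ k.+1 < a0 / (gamma * safe).
  rewrite ltr_pdivlMr ?mulr_gt0// exprS mulrACA mulVf ?gt_eqF// mul1r.
  by rewrite exprVn ltr_pdivrMl ?gamma_pow_gt0// backtracks_reject.
have : k.+1%:R < ln (a0 / (gamma * safe)) / ln gamma^-1.
  rewrite ltr_pdivlMr// mulr_natl -lnXn ?invr_gt0// ltr_ln//.
    by rewrite posrE exprn_gt0// invr_gt0.
  by rewrite posrE divr_gt0// mulr_gt0.
rewrite -[k.+2]addn1 natrD; lra.
Qed.

End Backtracking.

Section Iteration.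
Context {R : realType} {D d : nat} (pb : problem R D d) (s : mmls R D d).
Context (abar gamma delta : R).
Hypotheses (hpb : problem_spec pb) (hs : mmls_spec pb s) (habar : 0 < abar)
  (hgamma : 0 < gamma < 1) (hdelta : 0 < delta < 4^-1)
  (hLv : 6 * Lv s <= Qret pb s).
Let Q := Qret pb s.
Let a := step_floor s abar gamma delta.

Lemma threshold_gt0 p : 0 < threshold pb s abar p.
Proof. by rewrite /threshold lt_max divr_gt0// mulr_gt0// (Lv_gt0 hs). Qed.

Lemma step_floor_gt0 : 0 < a.
Proof.
have [g0 _] := andP hgamma; have [_ d4] := andP hdelta.
rewrite /a /step_floor lt_min habar/= divr_gt0 ?(Ltil_gt0 hs)//.
by rewrite !mulr_gt0// subr_gt0.
Qed.

Section OneIteration.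
Context (x p : 'rV[R]_D).
Hypotheses (Mp : manif pb p) (px : Pm s p = x) (man_x : Mt_manifold_at pb s x)
  (hthr : threshold pb s abar p <= enorm (gradt s x)).
Let gt := gradt s x.
Let safe := 2 * (beta pb s x p / 2 - delta) / Ltil s.

Lemma gradt_gt0 : 0 < enorm gt.
Proof. exact: lt_le_trans (threshold_gt0 p) hthr. Qed.

Local Lemma gradt_big : 2 * Ebound pb s p <= enorm gt.
Proof. by apply: le_trans hthr; rewrite /threshold le_max lexx orbT. Qed.

Lemma alpha0_gt0 : 0 < alpha0 pb s abar x.
Proof.
by rewrite /alpha0 lt_min habar/= divr_gt0 ?(Qret_gt0 hs)// gradt_gt0.
Qed.

Lemma beta_ge : 2^-1 <= beta pb s x p.
Proof.
move: man_x gradt_gt0 gradt_big; rewrite /gt -px => man_x' g0 gb.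
by have /andP[] := beta_bounds hpb hs Mp man_x' g0 gb.
Qed.

Local Lemma safe_gt0 : 0 < safe.
Proof.
rewrite /safe divr_gt0 ?(Ltil_gt0 hs)// mulr_gt0//.
have [_ d4] := andP hdelta; have := beta_ge; lra.
Qed.

Local Lemma short_step_ok alpha : 0 <= alpha -> alpha <= alpha0 pb s abar x ->
  alpha <= safe -> ~ insufficient pb s delta alpha x.
Proof.
move=> al0 al1; move: man_x gradt_gt0 gradt_big al1; rewrite /safe /gt -px.
move=> man_x' g0 gb; rewrite le_min => /andP[_ al1].
apply: (sufficient_decrease hpb hs Mp man_x' hLv g0 gb) => //.
by rewrite -ler_pdivlMr.
Qed.

Lemma iteration_exists :
  exists k, backtracks pb s gamma delta (alpha0 pb s abar x) x k.
Proof. exact: (backtracks_exists hgamma alpha0_gt0 safe_gt0 short_step_ok). Qed.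

Lemma iteration_cost k :
  backtracks pb s gamma delta (alpha0 pb s abar x) x k ->
  k.+1%:R <= eval_bound pb s abar gamma delta x p.
Proof.
move=> /(backtracks_count hgamma alpha0_gt0 safe_gt0 short_step_ok).
congr (_ <= Num.max 1 (2 + ln _ / _)); rewrite /safe.
have [g0 _] := andP hgamma; have [_ d4] := andP hdelta; have := beta_ge => bge.
field; rewrite !gt_eqF ?(Ltil_gt0 hs)//; lra.
Qed.

(** By [beta >= 1/2] the accepted step is at least the smaller of [a] and
    [Q / enorm gt], uniformly in the iterate. *)
Lemma iteration_decrease k :
  backtracks pb s gamma delta (alpha0 pb s abar x) x k ->
  delta * Num.min (a * enorm gt ^+ 2) (Q * enorm gt)
    <= cost pb x
       - cost pb (Rt s x (- ((gamma ^+ k * alpha0 pb s abar x) *: gt))).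
Proof.
move=> bk; have [_ /negP] := bk; rewrite -leNgt -/gt.
apply: le_trans; have [d0 d4] := andP hdelta; rewrite -mulrA ler_pM2l//.
have g0 := gradt_gt0; have [gam0 _] := andP hgamma.
have ge := backtracks_step_ge hgamma alpha0_gt0 short_step_ok bk.
apply: le_trans (ler_wpM2r (sqr_ge0 (enorm gt)) ge).
have le1 : Num.min a (Q / enorm gt)
    <= Num.min (alpha0 pb s abar x) (gamma * safe).
  have aM : Num.min a (Q / enorm gt) <= a by rewrite ge_min lexx.
  rewrite le_min; apply/andP; split; last first.
    apply: le_trans aM _; rewrite /a /step_floor ge_min; apply/orP; right.
    rewrite /safe mulrA ler_pM2r ?invr_gt0 ?(Ltil_gt0 hs)//.
    rewrite mulrA [gamma * 2]mulrC ler_pM2l ?mulr_gt0//.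
    have := beta_ge; lra.
  rewrite /alpha0 le_min; apply/andP; split; last by rewrite ge_min lexx orbT.
  by apply: le_trans aM _; rewrite /a /step_floor ge_min lexx.
apply: le_trans (ler_wpM2r (sqr_ge0 (enorm gt)) le1).
have -> : Q * enorm gt = Q / enorm gt * enorm gt ^+ 2.
  by rewrite expr2 mulrA divfK ?gt_eqF.
by rewrite -minr_pMl ?sqr_ge0.
Qed.

End OneIteration.
End Iteration.

(** * Complexity of a run, and the limit of small fill distance *)

Section Run.
Context {R : realType} {D d : nat} (pb : problem R D d) (s : mmls R D d).
Context (abar gamma delta : R).
Hypotheses (hpb : problem_spec pb) (hs : mmls_spec pb s) (habar : 0 < abar)
  (hgamma : 0 < gamma < 1) (hdelta : 0 < delta < 4^-1)
  (hLv : 6 * Lv s <= Qret pb s).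
Context (x0 : 'rV[R]_D) (N : nat) (x p : nat -> 'rV[R]_D).
Hypothesis (hr : run pb s abar gamma delta x0 N x p).
Let Q := Qret pb s.
Let a := step_floor s abar gamma delta.
Let g i := enorm (gradt s (x i)).
Let w e := Num.min (a * e ^+ 2) (Q * e).

Local Lemma a_gt0 : 0 < a.
Proof. exact: step_floor_gt0 hs habar hgamma hdelta. Qed.

Local Lemma w_gt0 e : 0 < e -> 0 < w e.
Proof.
by move=> e0; rewrite /w lt_min !mulr_gt0 ?a_gt0 ?(Qret_gt0 hs)// exprn_gt0.
Qed.

Local Lemma w_lt e e' : 0 < e -> e < e' -> w e < w e'.
Proof.
move=> e0 ee'; rewrite /w lt_min !gt_min !ltr_pM2l ?a_gt0 ?(Qret_gt0 hs)//.
by rewrite ee' orbT andbT ltr_pXn2r ?nnegrE ?ee' ?(ltW (lt_trans e0 ee')) ?ltW.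
Qed.

Lemma run_Mt i : (i <= N)%N -> Mt pb s (x i).
Proof. by move=> /(run_base hr)[Mp px]; exists (p i). Qed.

Lemma run_gradt_gt0 i : (i < N)%N -> 0 < g i.
Proof. by move=> iN; exact: (gradt_gt0 hs habar (run_threshold hr iN)). Qed.

Lemma run_decrease i : (i < N)%N ->
  delta * w (g i) <= cost pb (x i) - cost pb (x i.+1).
Proof.
move=> iN; have [Mp px] := run_base hr (ltnW iN).
have man_x := run_manifold hr iN; have ht := run_threshold hr iN.
have [k bk] := iteration_exists hpb hs habar hgamma hdelta hLv Mp px man_x ht.
rewrite (run_step hr iN bk).
exact: (iteration_decrease hpb hs habar hgamma hdelta hLv Mp px man_x ht).
Qed.

Lemma run_cost_le k : (k <= N)%N -> cost pb (x k) <= cost pb x0.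
Proof.
elim: k => [|k IHk] kN; first by rewrite (run_start hr).
apply: le_trans (IHk (ltnW kN)); rewrite -subr_ge0.
apply: le_trans (run_decrease kN).
have [d0 _] := andP hdelta.
by rewrite mulr_ge0 ?ltW// w_gt0// run_gradt_gt0.
Qed.

Lemma run_total_decrease e n : (n < N)%N -> 0 < e ->
  (forall i, (i <= n)%N -> e < g i) ->
  n.+1%:R * (delta * w e) < cost pb x0 - cost pb (x n.+1).
Proof.
move=> nN e0 big; have [d0 _] := andP hdelta.
have step i : (i <= n)%N -> delta * w e < cost pb (x i) - cost pb (x i.+1).
  move=> le_in; apply: lt_le_trans (run_decrease (leq_ltn_trans le_in nN)).
  by rewrite ltr_pM2l// w_lt// big.
elim: n {nN big} step => [|n IHn] step.
  by rewrite mul1r -(run_start hr); exact: step.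
have := IHn (fun i le_in => step i (leqW le_in)).
have := step n.+1 (leqnn _).
by rewrite -[n.+2%:R]natr1 mulrDl mul1r; lra.
Qed.

(** The two regimes of the iteration bound are the two branches of the minimum
    [w e], the decrease guaranteed by one iteration up to the factor [delta]. *)
Lemma iter_boundE e : 0 < e ->
  iter_bound pb s abar gamma delta x0 e
    = Num.ceil ((cost pb x0 - fstar pb) / (delta * w e)).
Proof.
move=> e0; have [d0 _] := andP hdelta; have Q0 := Qret_gt0 hs.
rewrite /iter_bound -/a -/Q /w ltr_pdivrMr ?a_gt0//.
have -> : a * e ^+ 2 = e * a * e by rewrite expr2; ring.
case: ltP => Qea; congr Num.ceil.
  rewrite min_r; last by rewrite ler_pM2r// ltW.
  by field; rewrite !gt_eqF.
rewrite min_l; last by rewrite ler_pM2r.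
by field; rewrite !gt_eqF// a_gt0.
Qed.

(** Each iteration at which the approximate gradient exceeds [e] lowers the cost
    by more than [delta * w e], and only [cost x0 - fstar] is available.  If
    the bound is the integer [b], assuming that the iterates 0 to [b] are all
    bad allows [min (b + 1) N] such iterations: at least one, which settles
    the degenerate case [b = 0], and at least [b], which contradicts the
    budget. *)
Lemma run_reaches e : (0 < N)%N -> 0 < e ->
  iter_bound pb s abar gamma delta x0 e <= N%:Z ->
  exists k : nat, [/\ k%:Z <= iter_bound pb s abar gamma delta x0 e,
    (k <= N)%N & g k <= e].
Proof.
move=> N0 e0; rewrite iter_boundE//; have [d0 _] := andP hdelta.
have dw0 : 0 < delta * w e by rewrite mulr_gt0// w_gt0.
set q := _ / _; have q_ge0 : 0 <= q.
  rewrite divr_ge0 ?(ltW dw0)// subr_ge0 (cost_ge hs)//; right.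
  by rewrite -(run_start hr); exact: run_Mt.
have : 0 <= Num.ceil q by rewrite ceil_ge0 (lt_le_trans _ q_ge0) ?ltrN10.
have := ceil_ge q; case: (Num.ceil q) => // b qb _; rewrite lez_nat => bN.
apply: contrapT => none.
have big i : (i <= b)%N -> e < g i.
  move=> ib; rewrite ltNge; apply/negP => gi.
  by apply: none; exists i; split => //; exact: leq_trans bN.
pose n := minn b N.-1; have nN : (n < N)%N.
  by rewrite /n -[ltnRHS](prednK N0) ltnS geq_minr.
have bn : (b <= n.+1)%N by rewrite /n -minnSS prednK// leq_min leqnSn.
have big_n i : (i <= n)%N -> e < g i.
  by move=> le_in; apply: big; exact: leq_trans le_in (geq_minl _ _).
have := run_total_decrease nN e0 big_n.
apply/negP; rewrite -leNgt.
apply: (@le_trans _ _ (cost pb x0 - fstar pb)).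
  by rewrite lerD2l lerN2 (cost_ge hs)//; right; exact: run_Mt.
rewrite -ler_pdivrMr// (le_trans qb)// pmulrn ler_nat.
exact: bn.
Qed.

Lemma run_achieves k e : (k <= N)%N -> g k <= e ->
  achieves pb s x0 (x k) (p k) e.
Proof.
move=> kN ge; have [Mp px] := run_base hr kN.
split; [exact: run_Mt|exact: run_cost_le|exact: ge| |].
  by apply: (Rgrad_manif_le hpb hs Mp); rewrite px.
by rewrite -px enormC; exact: (c_MMLSP hs Mp).
Qed.

End Run.

Section Limit.
Context {R : realType} {D d : nat} (pb : problem R D d).
Context (s : nat -> mmls R D d) (p : nat -> 'rV[R]_D) (abar : R).
Hypotheses (hpb : problem_spec pb) (hs : forall k, mmls_spec pb (s k))
  (Mp : forall k, manif pb (p k)) (habar : 0 < abar)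
  (h_to0 : hfill (s k) @[k --> \oo] --> (0 : R))
  (Lv_to0 : Lv (s k) @[k --> \oo] --> (0 : R)).

Lemma fill_power_cvg0 : hfill (s k) ^+ degree pb @[k --> \oo] --> (0 : R).
Proof.
have -> : (0 : R) = 0 ^+ degree pb by rewrite expr0n gtn_eqF// (degree_gt0 hpb).
exact: (continuous_cvg _ (@exprn_continuous R (degree pb) 0) h_to0).
Qed.

Lemma Lv6_cvg0 : 6 * Lv (s k) @[k --> \oo] --> (0 : R).
Proof. by rewrite -(mulr0 6); exact: cvgMr. Qed.

(** The gradients stay bounded by [Gmax] while the base points vary, so every
    term is a fixed constant times a quantity dominated by [h ^+ m]. *)
Lemma Ebound_cvg0 : Ebound pb (s k) (p k) @[k --> \oo] --> (0 : R).
Proof.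
pose H k := hfill (s k) ^+ degree pb.
pose G k := enorm (gradient (cost pb) (p k)) * H k.
have H_ge0 k : 0 <= H k by rewrite exprn_ge0// ltW// (h_gt0 (hs k)).
have G_to0 : G k @[k --> \oo] --> (0 : R).
  apply: (@squeeze_cvgr _ _ _ _ (cst 0) (fun k => Gmax pb * H k)).
  - near=> k; rewrite mulr_ge0 ?enorm_ge0//= ler_wpM2r//.
    exact: (GmaxP hpb).
  - exact: cvg_cst.
  - by rewrite -(mulr0 (Gmax pb)); apply: cvgMr; exact: fill_power_cvg0.
pose S := Num.sqrt (D%:R : R).
have -> : (fun k => Ebound pb (s k) (p k))
    = (fun k => (2 * c_M pb + c_Mt pb) * S * G k
                + (c_f pb + c_MMLS pb) * S * H k).
  by apply/funext => k; rewrite /Ebound /G /H /S; ring.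
have -> : (0 : R) = (2 * c_M pb + c_Mt pb) * S * 0
    + (c_f pb + c_MMLS pb) * S * 0 by rewrite !mulr0 addr0.
apply: cvgD; apply: cvgMr => //; exact: fill_power_cvg0.
Unshelve. all: end_near. Qed.

(** The first argument of the maximum is positive, so the maximum lies between
    0 and the sum of the first argument and the modulus of the second. *)
Lemma threshold_cvg0 : threshold pb (s k) abar (p k) @[k --> \oo] --> (0 : R).
Proof.
apply: (@squeeze_cvgr _ _ _ _ (cst 0)
  (fun k => 6 * Lv (s k) / abar + `|2 * Ebound pb (s k) (p k)|)).
- near=> k; have Lv0 := Lv_gt0 (hs k).
  have u0 : 0 < 6 * Lv (s k) / abar by rewrite divr_gt0// mulr_gt0.
  rewrite /threshold le_max (ltW u0)/= ge_max.
  by rewrite lerDl normr_ge0/= (le_trans (ler_norm _))// lerDr ltW.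
- exact: cvg_cst.
- rewrite -(addr0 (0 : R)); apply: cvgD.
    by rewrite -(mul0r abar^-1); apply: cvgMl; exact: Lv6_cvg0.
  rewrite -(normr0 R); apply: cvg_norm.
  by rewrite -(mulr0 2); apply: cvgMr; exact: Ebound_cvg0.
Unshelve. all: end_near. Qed.

Lemma bound_M_cvg eps :
  bound_M pb (s k) (eps6 pb (s k) abar eps (p k)) @[k --> \oo] --> eps.
Proof.
rewrite /bound_M /eps6 -[X in _ --> X]add0r; apply: cvgD.
  rewrite -(mulr0 ((c_f pb + 2 * c_M pb * Gmax pb) * Num.sqrt D%:R)).
  by apply: cvgMr; exact: fill_power_cvg0.
rewrite -[X in _ --> X]add0r; apply: cvgD; last exact: cvg_cst.
exact: threshold_cvg0.
Qed.

End Limit.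

(** * The convergence theorem *)

Theorem theorem29 (R : realType) (D d : nat) (pb : problem R D d)
  (abar gamma delta : R) (hpb : problem_spec pb) (habar : 0 < abar)
  (hgamma : 0 < gamma < 1) (hdelta : 0 < delta < 4^-1) :
  (forall s : mmls R D d, mmls_spec pb s -> 6 * Lv s <= Qret pb s ->
   forall x0 : 'rV[R]_D, Mt pb s x0 ->
   (* accuracy *)
   (forall eps : R, 0 < eps ->
    (* enough iterations: N0 of them, or as many as the condition on the
       approximate gradient allows *)
    (exists N0 : nat, forall (N : nat) (x p : nat -> 'rV[R]_D),
       run pb s abar gamma delta x0 N x p ->
       (N0 <= N)%N \/ enorm (gradt s (x N)) < threshold pb s abar (p N) ->
       exists2 k : nat, (k <= N)%N &
         achieves pb s x0 (x k) (p k) (eps6 pb s abar eps (p k))) /\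
    (* iteration count, for a common accuracy e along the run *)
    (forall (N : nat) (x p : nat -> 'rV[R]_D) (e : R),
       run pb s abar gamma delta x0 N x p -> (0 < N)%N -> 0 < e ->
       (forall i, (i <= N)%N -> e <= eps6 pb s abar eps (p i)) ->
       iter_bound pb s abar gamma delta x0 e <= N%:Z ->
       exists2 k : nat, k%:Z <= iter_bound pb s abar gamma delta x0 e &
         achieves pb s x0 (x k) (p k) (eps6 pb s abar eps (p k))) /\
    (* iteration count, for the accuracy at a given base point *)
    (forall (N : nat) (x p : nat -> 'rV[R]_D) (p' : 'rV[R]_D),
       let e := eps6 pb s abar eps p' in
       run pb s abar gamma delta x0 N x p -> (0 < N)%N -> manif pb p' ->
       iter_bound pb s abar gamma delta x0 e <= N%:Z ->
       exists2 k : nat, k%:Z <= iter_bound pb s abar gamma delta x0 e &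
         achieves pb s x0 (x k) (p k) e)) /\
   (* cost of one iteration *)
   (forall (N : nat) (x p : nat -> 'rV[R]_D),
      run pb s abar gamma delta x0 N x p ->
      forall i, (i < N)%N ->
        [/\ 0 < alpha0 pb s abar (x i), 0 < beta pb s (x i) (p i)
          & exists2 k : nat,
              backtracks pb s gamma delta (alpha0 pb s abar (x i)) (x i) k &
              k.+1%:R <= eval_bound pb s abar gamma delta (x i) (p i)])) /\
  (* limit h -> 0 *)
  (forall (s : nat -> mmls R D d) (p : nat -> 'rV[R]_D) (eps : R),
     (forall k, mmls_spec pb (s k)) -> (forall k, manif pb (p k)) -> 0 < eps ->
     hfill (s k) @[k --> \oo] --> (0 : R) ->
     Lv (s k) @[k --> \oo] --> (0 : R) ->
     [/\ bound_M pb (s k) (eps6 pb (s k) abar eps (p k)) @[k --> \oo] --> eps,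
         6 * Lv (s k) @[k --> \oo] --> (0 : R)
       & threshold pb (s k) abar (p k) @[k --> \oo] --> (0 : R)]).
Proof.
split=> [s hs hLv x0 Mx0|s p eps hs Mp eps0 h0 L0]; last first.
  by split; [exact: bound_M_cvg|exact: Lv6_cvg0|exact: threshold_cvg0].
split=> [eps eps0|N x p hr i iN]; last first.
  have [Mp px] := run_base hr (ltnW iN).
  have man_x := run_manifold hr iN; have ht := run_threshold hr iN.
  split.
  - exact: (alpha0_gt0 hs habar ht).
  - by apply: lt_le_trans (beta_ge hpb hs habar Mp px man_x ht).
  have [k bk] := iteration_exists hpb hs habar hgamma hdelta hLv Mp px man_x ht.
  exists k => //.
  exact: (iteration_cost hpb hs habar hgamma hdelta hLv Mp px man_x ht bk).
have eps6_gt p : eps < eps6 pb s abar eps p.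
  by rewrite /eps6 ltrDr (threshold_gt0 hs habar).
split; [|split].
- exists `|iter_bound pb s abar gamma delta x0 eps|%N.+1 => N x p hr [N0N|gN].
    have N_gt0 : (0 < N)%N by exact: leq_ltn_trans N0N.
    have bN : iter_bound pb s abar gamma delta x0 eps <= N%:Z.
      by apply: le_trans (lez_abs _) _; rewrite lez_nat ltnW.
    have [k [_ kN gk]] :=
      run_reaches hpb hs habar hgamma hdelta hLv hr N_gt0 eps0 bN.
    exists k => //.
    apply: (run_achieves hpb hs habar hgamma hdelta hLv hr kN).
    exact: le_trans gk (ltW (eps6_gt _)).
  exists N => //.
  apply: (run_achieves hpb hs habar hgamma hdelta hLv hr (leqnn N)).
  by rewrite (le_trans (ltW gN))// /eps6 lerDl ltW.
- move=> N x p e hr N_gt0 e0 e_le bN.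
  have [k [kb kN gk]] :=
    run_reaches hpb hs habar hgamma hdelta hLv hr N_gt0 e0 bN.
  exists k => //.
  apply: (run_achieves hpb hs habar hgamma hdelta hLv hr kN).
  exact: le_trans gk (e_le _ kN).
- move=> N x p p' e hr N_gt0 Mp' bN.
  have e0 : 0 < e := lt_trans eps0 (eps6_gt p').
  have [k [kb kN gk]] :=
    run_reaches hpb hs habar hgamma hdelta hLv hr N_gt0 e0 bN.
  exists k => //.
  exact: (run_achieves hpb hs habar hgamma hdelta hLv hr kN).
Qed.
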